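(* Let $\kappa>0$ and let $\chi_\kappa$ be the operator on $C^\infty(\mathbb{R})$ given by $$(\chi_\kappa f)(x)=\frac{1}{\Gamma(\kappa)}\int_0^1(1-t)^{\kappa-1}f(tx)\,dt.$$ Then $\chi_\kappa$ is a topological isomorphism from $C^\infty(\mathbb{R})$ onto itself, and its inverse is given for all $f\in C^\infty(\mathbb{R})$ by $$\chi_\kappa^{-1}f(x)=\prod_{j=1}^n\Big(j+x\frac{d}{dx}\Big)\big(I^{\kappa,n-\kappa}f\big)(x),$$ where $n=\lceil\kappa\rceil$ is the smallest integer $\ge\kappa$.
   Context: $C^\infty(\mathbb{R})$ carries the topology defined by the seminorms $\|f\|_{n,a}=\sup_{0\le k\le n,\ x\in[-a,a]}|f^{(k)}(x)|$, $a>0$, $n\in\mathbb{N}$. For $\delta>0$ and $\gamma\in\mathbb{R}$ the Erdélyi–Kober fractional integral is $(I^{\gamma,\delta}f)(x)=\frac{1}{\Gamma(\delta)}\int_0^1(1-t)^{\delta-1}t^\gamma f(tx)\,dt$; for $\delta=0$ (which occurs when $\kappa$ is an integer) $I^{\gamma,0}$ is the identity operator. The product denotes composition of the commuting first-order differential operators $j+x\frac{d}{dx}$. *)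

(* Defs.v *)
From Stdlib Require Import Reals.
From Coquelicot Require Import Coquelicot.
Open Scope R_scope.

(* real power x^a for x > 0; value 0 for x <= 0 (only ever used on a set of
   measure zero, namely the endpoints of the integration interval). *)
Definition rpow (x a : R) : R := if Rle_dec x 0 then 0 else Rpower x a.

Definition Gamma (s : R) : R :=
  RInt_gen (fun t => rpow t (s - 1) * exp (- t)) (at_right 0) (Rbar_locally p_infty).

Definition smooth (f : R -> R) : Prop := forall (k : nat) (x : R), ex_derive_n f k x.

Definition seminorm (n : nat) (a : R) (f : R -> R) : Rbar :=
  Lub_Rbar (fun y => exists (k : nat) (x : R),
              (k <= n)%nat /\ Rabs x <= a /\ y = Rabs (Derive_n f k x)).

(* open subsets of C^infty(R) for the locally convex topology defined by the
   (directed) family of seminorms ||.||_{n,a}, a > 0, n in N.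
   A set of functions is identified with its trace on smooth functions. *)
Definition Cinf_open (U : (R -> R) -> Prop) : Prop :=
  forall f, smooth f -> U f ->
    exists (n : nat) (a eps : R), 0 < a /\ 0 < eps /\
      forall g, smooth g -> Rbar_lt (seminorm n a (fun x => g x - f x)) (Finite eps) -> U g.

Definition Cinf_continuous (T : (R -> R) -> (R -> R)) : Prop :=
  forall U, Cinf_open U -> Cinf_open (fun f => U (T f)).

Definition maps_smooth (T : (R -> R) -> (R -> R)) : Prop :=
  forall f, smooth f -> smooth (T f).

(* chi_kappa f (x) = 1/Gamma(kappa) int_0^1 (1-t)^(kappa-1) f(tx) dt
   (improper integral over (0,1), needed when kappa < 1) *)
Definition chi (kappa : R) (f : R -> R) : R -> R :=
  fun x => / Gamma kappa *
    RInt_gen (fun t => rpow (1 - t) (kappa - 1) * f (t * x)) (at_right 0) (at_left 1).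

Definition EK (gamma delta : R) (f : R -> R) : R -> R :=
  if Req_EM_T delta 0 then f else
  fun x => / Gamma delta *
    RInt_gen (fun t => rpow (1 - t) (delta - 1) * rpow t gamma * f (t * x))
      (at_right 0) (at_left 1).

Fixpoint theta_prod (n : nat) (g : R -> R) : R -> R :=
  match n with
  | O => g
  | S m => fun x => INR (S m) * theta_prod m g x + x * Derive (theta_prod m g) x
  end.

(* Main.v *)
(* On monomials, with [c_m := 1/Gamma(kappa) int_0^1 (1-t)^(kappa-1) t^m dt], both operators are
   diagonal: [chi x^m = c_m x^m], and the proposed inverse multiplies [x^m] by
   [(m+1)...(m+n)] times a second beta integral over [Gamma(n-kappa)].  The product of the two factors is 1:
   by the recurrence of the beta integral it does not depend on [m], and by
   [m^a B(a, p+m) -> Gamma(a)] it tends to 1.  All operators involved are linear, and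
   each C^infty seminorm of the image is controlled by one seminorm of the argument,
   because differentiating [int w(t) f(tx) dt] only replaces [w] by [t w] and [f] by [f'].
   Hence they are continuous, and the two inversion formulas extend
   from polynomials to all of [C^infty(R)] since polynomials are dense
   (Bernstein approximation of the top derivative, integrated repeatedly). *)
Require Import Defs.
From Stdlib Require Import Reals Lra Lia FunctionalExtensionality.
From Coquelicot Require Import Coquelicot.
Open Scope R_scope.

(** The gamma function enters only through the limit of rescaled beta integrals: no functional
    equation, no Euler beta formula and no exchange of two integrals is used. The limit is exactly 1
    because [kappa + (n - kappa) = n] is also the growth order of the product of the [n] Euler
    factors. Dilation by [t] in [(0,1)] maps [[-a,a]] into itself, and the Euler factors are local.
    So every estimate keeps its radius [a], only the number of derivatives may grow, and polynomial
    approximation on a single compact interval suffices. The recurring obstacle is that the kernels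
    may blow up at [t = 1]: integrals are limits along filters, and convergence must be established
    before linearity or comparison applies, since [RInt_gen] says nothing about a divergent
    integral. *)

(** * Improper integrals *)

(** Order-convexity ensures that an integral between two endpoints in [I] sees the integrand on [I]
    only. Stated for general filters, it serves both [(0,1)] and [(0,infinity)]. *)
Definition joins (I : R -> Prop) (Fa Fb : (R -> Prop) -> Prop) : Prop :=
  (forall x y z, I x -> I z -> Rmin x z <= y <= Rmax x z -> I y) /\ Fa I /\ Fb I.

Lemma ex_RInt_on (I : R -> Prop) Fa Fb (f : R -> R) (a b : R) :
  joins I Fa Fb -> (forall x, I x -> continuous f x) -> I a -> I b -> ex_RInt f a b.
Proof.
  intros [HI _] Hf Ha Hb; apply (ex_RInt_continuous (V := R_CompleteNormedModule)).
  intros z Hz; apply Hf; exact (HI a z b Ha Hb Hz).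
Qed.

Lemma abs_RInt_le_abs (f g : R -> R) (a b : R) :
  ex_RInt f a b -> ex_RInt g a b ->
  (forall x, Rmin a b <= x <= Rmax a b -> Rabs (f x) <= g x) ->
  Rabs (RInt f a b) <= Rabs (RInt g a b).
Proof.
  assert (H : forall a b, a <= b -> ex_RInt f a b -> ex_RInt g a b ->
    (forall x, a <= x <= b -> Rabs (f x) <= g x) -> Rabs (RInt f a b) <= Rabs (RInt g a b)).
  { intros c d Hcd Hf Hg H.
    apply Rle_trans with (RInt g c d); [|apply Rle_abs].
    exact (norm_RInt_le f g c d _ _ Hcd H (RInt_correct f c d Hf) (RInt_correct g c d Hg)). }
  intros Hf Hg Hfg; destruct (Rle_lt_dec a b) as [Hab|Hab].
  - rewrite Rmin_left, Rmax_right in Hfg by lra; auto.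
  - rewrite Rmin_right, Rmax_left in Hfg by lra.
    apply ex_RInt_swap in Hf; apply ex_RInt_swap in Hg.
    rewrite <- (opp_RInt_swap f), <- (opp_RInt_swap g) by assumption.
    unfold opp; simpl; rewrite !Rabs_Ropp; apply H; auto; lra.
Qed.

(** Cauchy criterion: moving the endpoints changes the integral of [f] by two end pieces, each
    dominated by the same piece of [g]. Such a piece is a difference of two integrals of [g] within
    [eps / 4] of [l], hence below [eps / 2]. *)
Lemma ex_RInt_gen_dominated (I : R -> Prop) (Fa Fb : (R -> Prop) -> Prop)
  {PA : ProperFilter Fa} {PB : ProperFilter Fb} (f g : R -> R) :
  joins I Fa Fb ->
  (forall x, I x -> continuous f x) -> (forall x, I x -> continuous g x) ->
  (forall x, I x -> Rabs (f x) <= g x) ->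
  ex_RInt_gen g Fa Fb -> ex_RInt_gen f Fa Fb.
Proof.
  intros HI Cf Cg Hfg [l Hl]; assert (HI' := HI); destruct HI' as [Hconv [Ha Hb]].
  (* The criterion for limits of relations asks that [is_RInt] eventually have exactly one value;
     continuity on [I] gives existence. *)
  apply (proj1 (filterlimi_locally_cauchy (F := filter_prod Fa Fb)
    (fun ab => is_RInt f (fst ab) (snd ab))
    (Filter_prod _ _ _ I I Ha Hb (fun a b Ia Ib => conj
      (ex_RInt_on I Fa Fb f a b HI Cf Ia Ib)
      (fun y1 y2 H1 H2 => eq_trans (eq_sym (is_RInt_unique f a b y1 H1))
        (is_RInt_unique f a b y2 H2)))))).
  intros eps.
  assert (He : 0 < eps / 4) by (destruct eps; simpl; lra).
  assert (HP := Hl (ball l (mkposreal _ He)) (locally_ball l (mkposreal _ He))).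
  unfold filtermapi in HP; destruct HP as [Q S HQ HS HQS].
  assert (E : forall a b, Q a -> S b -> Rabs (RInt g a b - l) < eps / 4).
  { intros a b Qa Sb; destruct (HQS a b Qa Sb) as [y [Hy1 Hy2]]; simpl in Hy1.
    rewrite (is_RInt_unique g a b y Hy1); exact Hy2. }
  exists (fun ab => (Q (fst ab) /\ I (fst ab)) /\ (S (snd ab) /\ I (snd ab))); split.
  { apply (Filter_prod _ _ _ (fun a => Q a /\ I a) (fun b => S b /\ I b));
      [apply filter_and; assumption|apply filter_and; assumption|].
    intros a b H1 H2; split; assumption. }
  intros [a b] [a' b'] [[Qa Ia] [Sb Ib]] [[Qa' Ia'] [Sb' Ib']] u v Hu Hv; simpl in *.
  assert (Xf : forall x y, I x -> I y -> ex_RInt f x y)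
    by (intros; apply (ex_RInt_on I Fa Fb); assumption).
  assert (Xg : forall x y, I x -> I y -> ex_RInt g x y)
    by (intros; apply (ex_RInt_on I Fa Fb); assumption).
  assert (D : forall x y, I x -> I y -> Rabs (RInt f x y) <= Rabs (RInt g x y)).
  { intros x y Ix Iy; apply abs_RInt_le_abs; auto.
    intros z Hz; apply Hfg; exact (Hconv x z y Ix Iy Hz). }
  assert (Chf : forall x y z, I x -> I y -> I z -> RInt f x y + RInt f y z = RInt f x z)
    by (intros x y z Ix Iy Iz; apply (RInt_Chasles f); auto).
  assert (Chg : forall x y z, I x -> I y -> I z -> RInt g x y + RInt g y z = RInt g x z)
    by (intros x y z Ix Iy Iz; apply (RInt_Chasles g); auto).
  rewrite <- (is_RInt_unique _ _ _ _ Hu), <- (is_RInt_unique _ _ _ _ Hv).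
  change (Rabs (RInt f a' b' - RInt f a b) < eps).
  assert (D1 := D a' a Ia' Ia); assert (D2 := D b b' Ib Ib').
  assert (G1 := Chg a' a b Ia' Ia Ib); assert (G2 := Chg a b b' Ia Ib Ib').
  assert (F1 := Chf a' a b Ia' Ia Ib); assert (F2 := Chf a' b b' Ia' Ib Ib').
  assert (E1 := E a b Qa Sb); assert (E2 := E a' b Qa' Sb); assert (E3 := E a b' Qa Sb').
  revert D1 D2 E1 E2 E3; unfold Rabs; repeat destruct Rcase_abs; lra.
Qed.

Lemma is_RInt_gen_antiderivative (I : R -> Prop) (Fa Fb : (R -> Prop) -> Prop)
  {PA : ProperFilter Fa} {PB : ProperFilter Fb} (F f : R -> R) (la lb : R) :
  joins I Fa Fb ->
  (forall x, I x -> is_derive F x (f x)) -> (forall x, I x -> continuous f x) ->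
  filterlim F Fa (locally la) -> filterlim F Fb (locally lb) ->
  is_RInt_gen f Fa Fb (lb - la).
Proof.
  intros [Hconv [Ha Hb]] HF Hf La Lb P [eps HP].
  assert (He : 0 < eps / 2) by (destruct eps; simpl; lra).
  assert (Ba := proj1 (filterlim_locally F la) La (mkposreal _ He)).
  assert (Bb := proj1 (filterlim_locally F lb) Lb (mkposreal _ He)).
  apply (Filter_prod _ _ _ (fun a => I a /\ ball la (mkposreal _ He) (F a))
    (fun b => I b /\ ball lb (mkposreal _ He) (F b)));
    [apply filter_and; assumption|apply filter_and; assumption|].
  intros a b [Ia Ea] [Ib Eb]; exists (F b - F a); split.
  - apply (is_RInt_derive F f); intros x Hx; [apply HF|apply Hf];
      exact (Hconv a x b Ia Ib Hx).
  - apply HP; change (Rabs (F b - F a - (lb - la)) < eps).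
    change (Rabs (F a - la) < eps / 2) in Ea; change (Rabs (F b - lb) < eps / 2) in Eb.
    revert Ea Eb; unfold Rabs; repeat destruct Rcase_abs; lra.
Qed.

(** The classical substitution between eventual endpoints, with no monotonicity of [phi]; it will be
    applied to a decreasing map that reverses the ends. *)
Lemma is_RInt_gen_substitution (I : R -> Prop) (Fa Fb Ga Gb : (R -> Prop) -> Prop)
  {PA : ProperFilter Fa} {PB : ProperFilter Fb} (f phi dphi : R -> R) (l : R) :
  joins I Fa Fb ->
  (forall x, I x -> is_derive phi x (dphi x)) -> (forall x, I x -> continuous dphi x) ->
  (forall x, I x -> continuous f (phi x)) ->
  filterlim phi Fa Ga -> filterlim phi Fb Gb ->
  is_RInt_gen f Ga Gb l ->
  is_RInt_gen (fun x => dphi x * f (phi x)) Fa Fb l.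
Proof.
  intros [Hconv [Ha Hb]] Hphi Hdphi Hf La Lb Hl P HP.
  assert (H := Hl P HP); unfold filtermapi in H; destruct H as [Q S HQ HS HQS].
  apply (Filter_prod _ _ _ (fun a => I a /\ Q (phi a)) (fun b => I b /\ S (phi b)));
    [apply filter_and; [|apply La]; assumption|apply filter_and; [|apply Lb]; assumption|].
  intros a b [Ia Qa] [Ib Sb]; destruct (HQS _ _ Qa Sb) as [y [Hy Py]]; simpl in Hy |- *.
  exists y; split; [|exact Py].
  rewrite <- (is_RInt_unique _ _ _ _ Hy).
  apply (is_RInt_comp f phi dphi); intros x Hx;
    assert (Ix := Hconv a x b Ia Ib Hx); auto.
Qed.

Definition ordered_ends (Fa Fb : (R -> Prop) -> Prop) : Prop :=
  filter_prod Fa Fb (fun ab => fst ab <= snd ab).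

Lemma joins_between (I : R -> Prop) (Fa Fb : (R -> Prop) -> Prop)
  {PA : ProperFilter Fa} {PB : ProperFilter Fb} (P : R -> Prop) :
  joins I Fa Fb -> (forall x, I x -> P x) ->
  filter_prod Fa Fb (fun ab => forall x, Rmin (fst ab) (snd ab) <= x <= Rmax (fst ab) (snd ab) -> P x).
Proof.
  intros [Hconv [Ha Hb]] HP; apply (Filter_prod _ _ _ I I Ha Hb).
  intros a b Ia Ib x Hx; apply HP; exact (Hconv a x b Ia Ib Hx).
Qed.

Lemma is_RInt_gen_abs_le (I : R -> Prop) (Fa Fb : (R -> Prop) -> Prop)
  {PA : ProperFilter Fa} {PB : ProperFilter Fb} (f g : R -> R) (lf lg : R) :
  joins I Fa Fb -> ordered_ends Fa Fb ->
  (forall x, I x -> Rabs (f x) <= g x) ->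
  is_RInt_gen f Fa Fb lf -> is_RInt_gen g Fa Fb lg -> Rabs lf <= lg.
Proof.
  intros HI Ho Hfg Hf Hg; refine (RInt_gen_norm f g lf lg Ho _ Hf Hg).
  refine (filter_imp _ _ _ (filter_and (F := filter_prod Fa Fb) _ _ Ho
    (joins_between I Fa Fb _ HI Hfg))).
  intros [a b] [Hab H] x Hx; simpl in *.
  apply H; rewrite Rmin_left, Rmax_right; lra.
Qed.

Lemma is_RInt_gen_le (I : R -> Prop) (Fa Fb : (R -> Prop) -> Prop)
  {PA : ProperFilter Fa} {PB : ProperFilter Fb} (f g : R -> R) (lf lg : R) :
  joins I Fa Fb -> ordered_ends Fa Fb ->
  (forall x, I x -> f x <= g x) ->
  is_RInt_gen f Fa Fb lf -> is_RInt_gen g Fa Fb lg -> lf <= lg.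
Proof.
  intros HI Ho Hfg Hf Hg.
  assert (H := is_RInt_gen_minus _ _ _ _ Hg Hf).
  assert (K : Rabs (lg - lf) <= lg - lf).
  { refine (is_RInt_gen_abs_le I Fa Fb _ _ _ _ HI Ho _ H H).
    intros x Ix; specialize (Hfg x Ix); unfold minus, plus, opp; simpl.
    rewrite Rabs_pos_eq; lra. }
  revert K; unfold Rabs; destruct Rcase_abs; lra.
Qed.

(** Agreement on [I] is enough, which lets [rpow] be traded for [Rpower] inside [(0,1)] whatever
    their default values at the ends. *)
Lemma is_RInt_gen_ext_on (I : R -> Prop) (Fa Fb : (R -> Prop) -> Prop)
  {PA : ProperFilter Fa} {PB : ProperFilter Fb} (f g : R -> R) (l : R) :
  joins I Fa Fb -> (forall x, I x -> f x = g x) ->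
  is_RInt_gen f Fa Fb l -> is_RInt_gen g Fa Fb l.
Proof.
  intros HI Hfg; apply is_RInt_gen_ext.
  refine (filter_imp _ _ _ (joins_between I Fa Fb _ HI Hfg)).
  intros [a b] H x Hx; apply H; simpl in *; lra.
Qed.

(** * Beta integrals and the gamma function *)

Notation is_RInt01 f l := (is_RInt_gen f (at_right 0) (at_left 1) l).
Notation RInt01 f := (RInt_gen f (at_right 0) (at_left 1)).

Lemma joins_01 : joins (fun t => 0 < t < 1) (at_right 0) (at_left 1).
Proof.
  split; [|split].
  - intros x y z Hx Hz; unfold Rmin, Rmax; destruct Rle_dec; lra.
  - exists (mkposreal 1 Rlt_0_1); intros y Hy Hy0.
    change (Rabs (y - 0) < 1) in Hy; revert Hy; unfold Rabs; destruct Rcase_abs; lra.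
  - exists (mkposreal 1 Rlt_0_1); intros y Hy Hy0.
    change (Rabs (y - 1) < 1) in Hy; revert Hy; unfold Rabs; destruct Rcase_abs; lra.
Qed.

Lemma ordered_ends_01 : ordered_ends (at_right 0) (at_left 1).
Proof.
  assert (H : 0 < 1 / 2) by lra.
  apply (Filter_prod _ _ _ (fun a => a <= 1 / 2) (fun b => 1 / 2 <= b)).
  - exists (mkposreal _ H); intros y Hy Hy0.
    change (Rabs (y - 0) < 1 / 2) in Hy; revert Hy; unfold Rabs; destruct Rcase_abs; lra.
  - exists (mkposreal _ H); intros y Hy Hy0.
    change (Rabs (y - 1) < 1 / 2) in Hy; revert Hy; unfold Rabs; destruct Rcase_abs; lra.
  - intros a b Ha Hb; simpl; lra.
Qed.

Lemma joins_0_infty : joins (fun t => 0 < t) (at_right 0) (Rbar_locally p_infty).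
Proof.
  split; [|split].
  - intros x y z Hx Hz; unfold Rmin, Rmax; destruct Rle_dec; lra.
  - exists (mkposreal 1 Rlt_0_1); intros y Hy Hy0; exact Hy0.
  - exists 0; intros y Hy; exact Hy.
Qed.

Lemma RInt01_correct (f : R -> R) :
  ex_RInt_gen f (at_right 0) (at_left 1) -> is_RInt01 f (RInt01 f).
Proof. apply (RInt_gen_correct (V := R_CompleteNormedModule)). Qed.

Lemma RInt01_unique (f : R -> R) (l : R) : is_RInt01 f l -> RInt01 f = l.
Proof. apply (is_RInt_gen_unique (V := R_CompleteNormedModule)). Qed.

Lemma rpow_Rpower (x a : R) : 0 < x -> rpow x a = Rpower x a.
Proof. intros Hx; unfold rpow; destruct Rle_dec; [lra|reflexivity]. Qed.

Lemma exp_le (x y : R) : x <= y -> exp x <= exp y.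
Proof. intros [H| ->]; [left; apply exp_increasing, H|right; reflexivity]. Qed.

Lemma Rpower_gt0 (x a : R) : 0 < Rpower x a.
Proof. apply exp_pos. Qed.

Lemma continuous_Rpower (x a : R) : 0 < x -> continuous (fun t => Rpower t a) x.
Proof.
  intros Hx; apply (ex_derive_continuous (V := R_NormedModule)); unfold Rpower.
  auto_derive; exact Hx.
Qed.

Lemma is_derive_Rpower (x a : R) : 0 < x ->
  is_derive (fun t => Rpower t a) x (a * Rpower x (a - 1)).
Proof. intros Hx; apply is_derive_Reals, derivable_pt_lim_power, Hx. Qed.

Lemma Rpower_m1 (x a : R) : 0 < x -> Rpower x a = x * Rpower x (a - 1).
Proof.
  intros Hx; rewrite <- (Rpower_1 x Hx) at 2; rewrite <- Rpower_plus; f_equal; lra.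
Qed.

Lemma Rpower_le_base_le1 (t a b : R) : 0 < t <= 1 -> a <= b -> Rpower t b <= Rpower t a.
Proof.
  intros Ht Hab; unfold Rpower; apply exp_le.
  assert (ln t <= 0) by (rewrite <- ln_1; apply ln_le; lra); nra.
Qed.

Lemma Rpower_base_1 (a : R) : Rpower 1 a = 1.
Proof. unfold Rpower; rewrite ln_1, Rmult_0_r; apply exp_0. Qed.

Lemma Rpower_le1 (t a : R) : 0 < t <= 1 -> 0 <= a -> Rpower t a <= 1.
Proof.
  intros Ht Ha; rewrite <- (Rpower_O t) by lra; apply Rpower_le_base_le1; lra.
Qed.

Lemma filterlim_Rpower_0 (a : R) : 0 < a ->
  filterlim (fun t => Rpower t a) (at_right 0) (locally 0).
Proof.
  intros Ha; apply filterlim_locally; intros eps.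
  exists (mkposreal _ (Rpower_gt0 eps (/ a))); intros t Ht Ht0.
  change (Rabs (t - 0) < Rpower eps (/ a)) in Ht.
  change (Rabs (Rpower t a - 0) < eps).
  rewrite Rminus_0_r, Rabs_pos_eq in Ht |- * by (apply Rlt_le; try exact Ht0; apply Rpower_gt0).
  replace (pos eps) with (Rpower (Rpower eps (/ a)) a).
  - apply Rlt_Rpower_l; lra.
  - rewrite Rpower_mult, Rinv_l by lra; apply Rpower_1; destruct eps; assumption.
Qed.

Lemma filterlim_1_minus : filterlim (fun t => 1 - t) (at_left 1) (at_right 0).
Proof.
  intros P [eps HP]; exists eps; intros y Hy Hy1; apply HP; [|lra].
  change (Rabs (y - 1) < eps) in Hy; change (Rabs (1 - y - 0) < eps).
  rewrite Rminus_0_r, Rabs_minus_sym; exact Hy.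
Qed.

Lemma filterlim_Rpower_1_minus (a : R) : 0 < a ->
  filterlim (fun t => Rpower (1 - t) a) (at_left 1) (locally 0).
Proof.
  intros Ha; exact (filterlim_comp _ _ _ _ _ _ _ _ filterlim_1_minus (filterlim_Rpower_0 a Ha)).
Qed.

Lemma continuous_at_right (f : R -> R) (x : R) :
  continuous f x -> filterlim f (at_right x) (locally (f x)).
Proof. intros H P HP; apply filter_le_within, (H P HP). Qed.

Lemma continuous_at_left (f : R -> R) (x : R) :
  continuous f x -> filterlim f (at_left x) (locally (f x)).
Proof. intros H P HP; apply filter_le_within, (H P HP). Qed.

(** Raise [t / (2 s) <= exp (t / (2 s))] to the power [s]. The rate [t / 2] is chosen so that the
    square of the bound is absorbed by [exp (- t)]. *)
Lemma Rpower_le_exp (s t : R) : 0 < s -> 0 < t ->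
  Rpower t s <= Rpower (2 * s) s * exp (t / 2).
Proof.
  intros Hs Ht.
  assert (E : exp (t / 2) = Rpower (exp (t / (2 * s))) s).
  { unfold Rpower; rewrite ln_exp; f_equal; field; lra. }
  rewrite E, Rpower_mult_distr by (try apply exp_pos; lra).
  apply Rle_Rpower_l; [lra|split; [exact Ht|]].
  assert (H := exp_ineq1_le (t / (2 * s))).
  replace t with (2 * s * (t / (2 * s))) at 1 by (field; lra).
  apply Rmult_le_compat_l; lra.
Qed.

Lemma filterlim_scal_left (F : (R -> Prop) -> Prop) (c l : R) (f : R -> R) :
  filterlim f F (locally l) -> filterlim (fun t => c * f t) F (locally (c * l)).
Proof.
  intros H; exact (filterlim_comp _ _ _ f (fun x => c * x) F (locally l) _ H
    (filterlim_scal_r (K := R_AbsRing) (V := R_NormedModule) c l)).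
Qed.

Lemma Gamma_correct (s : R) : 0 < s ->
  is_RInt_gen (fun t => rpow t (s - 1) * exp (- t)) (at_right 0) (Rbar_locally p_infty) (Gamma s).
Proof.
  intros Hs; apply (RInt_gen_correct (V := R_CompleteNormedModule)).
  set (K := Rpower (2 * s) s); assert (HK : 0 < K) by apply Rpower_gt0.
  (* [(1 + K)^2] bounds [(1 + t^s)^2 exp (- t)], and [/ s] cancels the factor [s] produced by
     differentiation. One majorant serves both ends, without splitting the half-line. *)
  set (C := (1 + K) * (1 + K) / s).
  assert (P1 : forall t, 0 < 1 + Rpower t s) by (intros t; assert (H := Rpower_gt0 t s); lra).
  (* [t^s / (1 + t^s)] has limits at both ends, and its derivative dominates the integrand up to a constant. *)
  assert (D : forall t, 0 < t -> is_derive (fun t => C * (1 - / (1 + Rpower t s))) t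
    (C * (s * Rpower t (s - 1) / ((1 + Rpower t s) * (1 + Rpower t s))))).
  { intros t Ht; assert (H := P1 t).
    replace (Rpower t (s - 1)) with (Rpower t s / t) by (rewrite (Rpower_m1 t s Ht); field; lra).
    unfold Rpower in *; auto_derive; [repeat split; lra|field; lra]. }
  assert (Cg : forall t, 0 < t -> continuous (fun t =>
     C * (s * Rpower t (s - 1) / ((1 + Rpower t s) * (1 + Rpower t s)))) t).
  { intros t Ht; apply (ex_derive_continuous (V := R_NormedModule)); unfold Rpower.
    auto_derive; repeat split; try exact Ht.
    assert (H := P1 t); unfold Rpower in H; apply Rgt_not_eq; nra. }
  apply (ex_RInt_gen_dominated (fun t => 0 < t) _ _ _ _ joins_0_infty) with (2 := Cg).
  - intros t Ht; apply (continuous_ext_loc _ (fun t => Rpower t (s - 1) * exp (- t))).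
    + exists (mkposreal t Ht); intros y Hy; rewrite rpow_Rpower; [reflexivity|].
      change (Rabs (y - t) < t) in Hy; revert Hy; unfold Rabs; destruct Rcase_abs; lra.
    + apply (ex_derive_continuous (V := R_NormedModule)); unfold Rpower; auto_derive; exact Ht.
  - intros t Ht; rewrite rpow_Rpower by exact Ht.
    assert (Hp := Rpower_gt0 t (s - 1)); assert (He := exp_pos (- t)); assert (H1 := P1 t).
    rewrite Rabs_pos_eq by nra.
    assert (H2 : (1 + Rpower t s) <= (1 + K) * exp (t / 2)).
    { assert (H := Rpower_le_exp s t Hs Ht); fold K in H.
      assert (1 <= exp (t / 2)) by (rewrite <- exp_0; apply exp_le; lra); lra. }
    assert (H3 : (1 + Rpower t s) * (1 + Rpower t s) * exp (- t) <= (1 + K) * (1 + K)).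
    { replace ((1 + K) * (1 + K)) with (((1 + K) * exp (t / 2)) * ((1 + K) * exp (t / 2)) * exp (- t)).
      - apply Rmult_le_compat_r; [lra|]; apply Rmult_le_compat; lra.
      - transitivity ((1 + K) * (1 + K) * (exp (t / 2) * exp (t / 2) * exp (- t))); [ring|].
        rewrite <- !exp_plus; replace (t / 2 + t / 2 + - t) with 0 by field; rewrite exp_0; ring. }
    unfold C; replace ((1 + K) * (1 + K) / s * (s * Rpower t (s - 1) / ((1 + Rpower t s) * (1 + Rpower t s))))
      with (Rpower t (s - 1) * ((1 + K) * (1 + K) / ((1 + Rpower t s) * (1 + Rpower t s)))) by (field; lra).
    apply Rmult_le_compat_l; [lra|].
    apply Rle_div_r; [nra|]; lra.
  - exists (C * 1 - C * 0).
    apply (is_RInt_gen_antiderivative _ _ _ _ _ _ _ joins_0_infty D Cg);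
      apply filterlim_scal_left.
    + apply filterlim_locally; intros eps.
      generalize (proj1 (filterlim_locally _ _) (filterlim_Rpower_0 s Hs) eps).
      apply filter_imp; intros t Ht.
      change (Rabs (Rpower t s - 0) < eps) in Ht; change (Rabs (1 - / (1 + Rpower t s) - 0) < eps).
      assert (H1 := P1 t); assert (Hp := Rpower_gt0 t s).
      rewrite Rminus_0_r in Ht |- *; rewrite Rabs_pos_eq in Ht by lra.
      replace (1 - / (1 + Rpower t s)) with (Rpower t s / (1 + Rpower t s)) by (field; lra).
      rewrite Rabs_pos_eq by (apply Rlt_le, Rdiv_lt_0_compat; lra).
      apply Rle_lt_trans with (2 := Ht); apply Rle_div_l; nra.
    + apply filterlim_locally; intros eps.
      (* Beyond this threshold [t^s > / eps]. *)
      exists (Rpower (/ eps) (/ s)); intros t Ht.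
      assert (Ht0 : 0 < t) by (assert (H := Rpower_gt0 (/ eps) (/ s)); lra).
      change (Rabs (1 - / (1 + Rpower t s) - 1) < eps).
      replace (1 - / (1 + Rpower t s) - 1) with (- / (1 + Rpower t s)) by lra.
      assert (H1 := P1 t); assert (Hp := Rpower_gt0 t s).
      rewrite Rabs_Ropp, Rabs_pos_eq by (apply Rlt_le, Rinv_0_lt_compat; lra).
      assert (He : 0 < / eps) by (apply Rinv_0_lt_compat; destruct eps; assumption).
      assert (H : / eps < Rpower t s).
      { replace (/ eps) with (Rpower (Rpower (/ eps) (/ s)) s).
        - apply Rlt_Rpower_l; [lra|]; split; [apply Rpower_gt0|exact Ht].
        - rewrite Rpower_mult, Rinv_l by lra; apply Rpower_1, He. }
      rewrite <- (Rinv_inv eps); apply Rinv_lt_contravar; nra.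
Qed.

(** This is Euler's [B(a, p + 1)]; the shift makes [p] the exponent of [t], so that moments of order
    [m] occur at [p = m]. *)
Definition beta01 (a p : R) : R := RInt01 (fun t => Rpower (1 - t) (a - 1) * Rpower t p).

Lemma continuous_Rpower_1_minus (x a : R) : x < 1 -> continuous (fun t => Rpower (1 - t) a) x.
Proof.
  intros Hx; apply (ex_derive_continuous (V := R_NormedModule)); unfold Rpower.
  auto_derive; lra.
Qed.

Lemma is_derive_Rpower_1_minus (x a : R) : x < 1 ->
  is_derive (fun t => Rpower (1 - t) a) x (- (a * Rpower (1 - x) (a - 1))).
Proof.
  intros Hx.
  replace (a * Rpower (1 - x) (a - 1)) with (a * (Rpower (1 - x) a / (1 - x)))
    by (rewrite (Rpower_m1 (1 - x) a) by lra; field; lra).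
  unfold Rpower; auto_derive; [lra|fold (1 - x); field; lra].
Qed.

Lemma is_RInt01_pow_1_minus (a : R) : 0 < a ->
  is_RInt01 (fun t => Rpower (1 - t) (a - 1)) (/ a).
Proof.
  intros Ha; replace (/ a) with ((- / a) * 0 - (- / a) * Rpower (1 - 0) a)
    by (rewrite Rminus_0_r, Rpower_base_1; ring).
  apply (is_RInt_gen_antiderivative _ _ _ (fun t => (- / a) * Rpower (1 - t) a) _ _ _ joins_01).
  - intros x Hx.
    replace (Rpower (1 - x) (a - 1)) with ((- / a) * (- (a * Rpower (1 - x) (a - 1)))) by (field; lra).
    apply (is_derive_scal (fun t => Rpower (1 - t) a)), is_derive_Rpower_1_minus; lra.
  - intros x Hx; apply continuous_Rpower_1_minus; lra.
  - apply filterlim_scal_left, (continuous_at_right (fun t => Rpower (1 - t) a)), continuous_Rpower_1_minus; lra.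
  - apply filterlim_scal_left, filterlim_Rpower_1_minus, Ha.
Qed.

Lemma beta01_correct (a p : R) : 0 < a -> 0 <= p ->
  is_RInt01 (fun t => Rpower (1 - t) (a - 1) * Rpower t p) (beta01 a p).
Proof.
  intros Ha Hp; apply RInt01_correct.
  apply (ex_RInt_gen_dominated _ _ _ _ (fun t => Rpower (1 - t) (a - 1)) joins_01).
  - intros x Hx; apply (continuous_mult (K := R_AbsRing)).
    + apply continuous_Rpower_1_minus; lra.
    + apply continuous_Rpower; lra.
  - intros x Hx; apply continuous_Rpower_1_minus; lra.
  - intros x Hx; assert (H1 := Rpower_gt0 (1 - x) (a - 1)); assert (H2 := Rpower_gt0 x p).
    assert (H3 : Rpower x p <= 1) by (apply Rpower_le1; lra).
    rewrite Rabs_pos_eq by nra; nra.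
  - exists (/ a); apply is_RInt01_pow_1_minus, Ha.
Qed.

Lemma beta01_0 (a : R) : 0 < a -> beta01 a 0 = / a.
Proof.
  intros Ha; unfold beta01; apply RInt01_unique.
  apply (is_RInt_gen_ext_on _ _ _ (fun t => Rpower (1 - t) (a - 1)) _ _ joins_01).
  - intros x Hx; rewrite Rpower_O by lra; ring.
  - apply is_RInt01_pow_1_minus, Ha.
Qed.

Lemma filterlim_Rmult (F : (R -> Prop) -> Prop) {FF : Filter F} (f g : R -> R) (a b : R) :
  filterlim f F (locally a) -> filterlim g F (locally b) ->
  filterlim (fun t => f t * g t) F (locally (a * b)).
Proof.
  intros Hf Hg; exact (filterlim_comp_2 f g Rmult Hf Hg (filterlim_mult (K := R_AbsRing) a b)).
Qed.

Lemma beta01_succ (a p : R) : 0 < a -> 0 <= p ->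
  (a + p + 1) * beta01 a (p + 1) = (p + 1) * beta01 a p.
Proof.
  intros Ha Hp.
  assert (H0 := is_RInt_gen_scal _ (p + 1) _ (beta01_correct a p Ha Hp)).
  assert (Hp1 : 0 <= p + 1) by lra.
  assert (H1 := is_RInt_gen_scal _ (a + p + 1) _ (beta01_correct a (p + 1) Ha Hp1)).
  assert (H := is_RInt_gen_minus _ _ _ _ H0 H1).
  (* the integrand of the difference is the derivative of [(1-t)^a t^(p+1)] *)
  set (F := fun t => Rpower (1 - t) a * Rpower t (p + 1)).
  (* The value is left as the limit of [F] at 1 minus its limit at 0, each a product of limits; both
     vanish. *)
  assert (HF : is_RInt01 (fun t => (p + 1) * (Rpower (1 - t) (a - 1) * Rpower t p)
     - (a + p + 1) * (Rpower (1 - t) (a - 1) * Rpower t (p + 1))) (0 * Rpower 1 (p + 1) - Rpower (1 - 0) a * 0)).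
  { apply (is_RInt_gen_antiderivative _ _ _ F _ _ _ joins_01).
    - intros x Hx.
      assert (D := is_derive_mult (K := R_AbsRing) _ _ x _ _
        (is_derive_Rpower_1_minus x a (proj2 Hx)) (is_derive_Rpower x (p + 1) (proj1 Hx)) Rmult_comm).
      replace (_ - _) with (plus (mult (- (a * Rpower (1 - x) (a - 1))) (Rpower x (p + 1)))
        (mult (Rpower (1 - x) a) ((p + 1) * Rpower x (p + 1 - 1)))); [exact D|].
      unfold plus, mult; simpl.
      replace (p + 1 - 1) with p by ring.
      rewrite (Rpower_m1 (1 - x) a) by lra; rewrite (Rpower_m1 x (p + 1)) by lra.
      replace (p + 1 - 1) with p by ring; ring.
    - intros x Hx; apply (ex_derive_continuous (V := R_NormedModule)); unfold Rpower.
      auto_derive; repeat split; lra.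
    - apply (filterlim_Rmult (at_right 0) (fun t => Rpower (1 - t) a) (fun t => Rpower t (p + 1))).
      + apply (continuous_at_right (fun t => Rpower (1 - t) a)), continuous_Rpower_1_minus; lra.
      + apply filterlim_Rpower_0; lra.
    - apply (filterlim_Rmult (at_left 1) (fun t => Rpower (1 - t) a) (fun t => Rpower t (p + 1))).
      + apply filterlim_Rpower_1_minus, Ha.
      + apply (continuous_at_left (fun t => Rpower t (p + 1))), continuous_Rpower; lra. }
  change (is_RInt01 (fun t => (p + 1) * (Rpower (1 - t) (a - 1) * Rpower t p)
     - (a + p + 1) * (Rpower (1 - t) (a - 1) * Rpower t (p + 1)))
     ((p + 1) * beta01 a p - (a + p + 1) * beta01 a (p + 1))) in H.
  apply RInt01_unique in H; apply RInt01_unique in HF; rewrite H in HF; lra.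
Qed.

(** * Comparison of beta integrals with gamma integrals *)

Lemma ln_lt_0 (t : R) : 0 < t < 1 -> ln t < 0.
Proof. intros Ht; rewrite <- ln_1; apply ln_increasing; lra. Qed.

(** Substitute [s = - q ln t] in the gamma integral: [exp (- s)] becomes [t^q], [ds] becomes
    [- q / t dt], and the powers of [q] collect to [q^a]. *)
Lemma is_RInt01_Gamma (a q : R) : 0 < a -> 0 < q ->
  is_RInt01 (fun t => Rpower (- ln t) (a - 1) * Rpower t (q - 1)) (Rpower q (- a) * Gamma a).
Proof.
  intros Ha Hq.
  (* The substitution sends 0 to infinity and 1 to 0, so the gamma integral is first read backwards;
     the minus sign in the later scaling by [- Rpower q (- a)] undoes this. *)
  assert (S := is_RInt_gen_swap _ _ (Gamma_correct a Ha)).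
  assert (H : is_RInt01 (fun t => (- q * / t) *
    (rpow (- q * ln t) (a - 1) * exp (- (- q * ln t)))) (opp (Gamma a))).
  { apply (is_RInt_gen_substitution (fun t => 0 < t < 1) _ _ (Rbar_locally p_infty) (at_right 0)
      (fun t => rpow t (a - 1) * exp (- t)) (fun t => - q * ln t) (fun t => - q * / t) _ joins_01).
    - intros x Hx; auto_derive; [lra|ring].
    - intros x Hx; apply (ex_derive_continuous (V := R_NormedModule)); auto_derive; lra.
    - intros x Hx; assert (L := ln_lt_0 x Hx).
      assert (Hp : 0 < - q * ln x) by nra.
      apply (continuous_ext_loc _ (fun t => Rpower t (a - 1) * exp (- t))).
      + exists (mkposreal _ Hp); intros y Hy; rewrite rpow_Rpower; [reflexivity|].
        change (Rabs (y - (- q * ln x)) < - q * ln x) in Hy.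
        revert Hy; unfold Rabs; destruct Rcase_abs; lra.
      + apply (ex_derive_continuous (V := R_NormedModule)); unfold Rpower; auto_derive; exact Hp.
    - intros P [M HM].
      assert (Hm : at_right 0 (fun t => ln t < - (M / q)))
        by (apply (is_lim_ln_0 (fun y => y < - (M / q))); exists (- (M / q)); auto).
      refine (filter_imp _ _ _ Hm); intros t Ht; apply HM.
      apply Rmult_lt_compat_l with (r := q) in Ht; [|exact Hq].
      replace (q * - (M / q)) with (- M) in Ht by (field; lra); lra.
    - intros P [eps HP].
      assert (C : filterlim (fun t => - q * ln t) (at_left 1) (locally (- q * ln 1))).
      { apply (continuous_at_left (fun t => - q * ln t)).
        apply (ex_derive_continuous (V := R_NormedModule)); auto_derive; lra. }
      rewrite ln_1, Rmult_0_r in C.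
      refine (filter_imp _ _ _ (filter_and _ _ (proj1 (filterlim_locally _ _) C eps)
        (proj2 (proj2 joins_01)))).
      intros t [Ht1 Ht2]; apply HP; [exact Ht1|]; assert (L := ln_lt_0 t Ht2); nra.
    - exact S. }
  apply (is_RInt_gen_scal _ (- Rpower q (- a))) in H.
  replace (Rpower q (- a) * Gamma a) with (scal (- Rpower q (- a)) (opp (Gamma a)))
    by (unfold scal, opp; simpl; unfold mult; simpl; ring).
  revert H; apply (is_RInt_gen_ext_on _ _ _ _ _ _ joins_01); intros t Ht.
  assert (L := ln_lt_0 t Ht); unfold scal; simpl; unfold mult; simpl.
  rewrite rpow_Rpower by nra.
  replace (exp (- (- q * ln t))) with (Rpower t q) by (unfold Rpower; f_equal; ring).
  rewrite (Rpower_m1 t q) by lra.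
  replace (- q * ln t) with (q * - ln t) by ring.
  rewrite <- Rpower_mult_distr by lra.
  assert (E : Rpower q (- a) * (q * Rpower q (a - 1)) = 1).
  { rewrite <- Rpower_m1, <- Rpower_plus by exact Hq.
    rewrite Rplus_opp_l; apply Rpower_O, Hq. }
  transitivity ((Rpower q (- a) * (q * Rpower q (a - 1))) * (Rpower (- ln t) (a - 1) * Rpower t (q - 1))).
  - field; lra.
  - rewrite E; ring.
Qed.

Lemma Rpower_le_base_neg (x y a : R) : 0 < x <= y -> a <= 0 -> Rpower y a <= Rpower x a.
Proof.
  intros Hx Ha; replace a with (- - a) by ring.
  rewrite (Rpower_Ropp x), (Rpower_Ropp y).
  apply Rinv_le_contravar; [apply Rpower_gt0|]; apply Rle_Rpower_l; lra.
Qed.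

(* From [t * (- ln t) <= 1 - t <= - ln t]: raising to the power [a - 1] compares the
   beta integrand with two gamma integrands in the variable [- ln t]. *)
Lemma beta01_bounds (a p : R) : 0 < a -> 0 <= p ->
  (1 <= a -> Rpower (p + a) (- a) * Gamma a <= beta01 a p <= Rpower (p + 1) (- a) * Gamma a) /\
  (a <= 1 -> Rpower (p + 1) (- a) * Gamma a <= beta01 a p <= Rpower (p + a) (- a) * Gamma a).
Proof.
  intros Ha Hp.
  assert (Hpa : 0 < p + a) by lra; assert (Hp1 : 0 < p + 1) by lra.
  assert (B := beta01_correct a p Ha Hp).
  (* [q = p + a] belongs to the base [t * (- ln t)], whose factor [t^(a-1)] joins [t^p]; [q = p + 1]
     belongs to the base [- ln t]. The sign of [a - 1] decides which of the two is the upper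
     bound. *)
  assert (G1 := is_RInt01_Gamma a _ Ha Hpa); assert (G2 := is_RInt01_Gamma a _ Ha Hp1).
  (* Both inequalities are [1 + y <= exp y], taken at [y = ln t] and at [y = - ln t], the second
     multiplied by [t]. *)
  assert (L : forall t, 0 < t < 1 -> 0 < t * - ln t <= 1 - t /\ 1 - t <= - ln t).
  { intros t Ht; assert (L := ln_lt_0 t Ht).
    assert (E1 := exp_ineq1_le (ln t)); rewrite exp_ln in E1 by lra.
    assert (E2 := exp_ineq1_le (- ln t)); rewrite exp_Ropp, exp_ln in E2 by lra.
    assert (E3 : t * (1 + - ln t) <= t * / t) by (apply Rmult_le_compat_l; lra).
    rewrite Rinv_r in E3 by lra; nra. }
  assert (E1 : forall t, 0 < t < 1 -> Rpower (- ln t) (a - 1) * Rpower t (p + a - 1)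
     = Rpower (t * - ln t) (a - 1) * Rpower t p).
  { intros t Ht; assert (L' := ln_lt_0 t Ht).
    rewrite <- Rpower_mult_distr by lra.
    replace (p + a - 1) with ((a - 1) + p) by ring; rewrite Rpower_plus; ring. }
  assert (E2 : forall t, Rpower (- ln t) (a - 1) * Rpower t (p + 1 - 1)
     = Rpower (- ln t) (a - 1) * Rpower t p).
  { intros t; replace (p + 1 - 1) with p by ring; reflexivity. }
  split; intros Ha1; split.
  - refine (is_RInt_gen_le _ _ _ _ _ _ _ joins_01 ordered_ends_01 _ G1 B); intros t Ht.
    rewrite E1 by exact Ht; destruct (L t Ht) as [? ?]; apply Rmult_le_compat_r; [apply Rlt_le, Rpower_gt0|].
    apply Rle_Rpower_l; lra.
  - refine (is_RInt_gen_le _ _ _ _ _ _ _ joins_01 ordered_ends_01 _ B G2); intros t Ht.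
    rewrite E2; destruct (L t Ht) as [? ?]; apply Rmult_le_compat_r; [apply Rlt_le, Rpower_gt0|].
    apply Rle_Rpower_l; lra.
  - refine (is_RInt_gen_le _ _ _ _ _ _ _ joins_01 ordered_ends_01 _ G2 B); intros t Ht.
    rewrite E2; destruct (L t Ht) as [? ?]; apply Rmult_le_compat_r; [apply Rlt_le, Rpower_gt0|].
    apply Rpower_le_base_neg; lra.
  - refine (is_RInt_gen_le _ _ _ _ _ _ _ joins_01 ordered_ends_01 _ B G1); intros t Ht.
    rewrite E1 by exact Ht; destruct (L t Ht) as [? ?]; apply Rmult_le_compat_r; [apply Rlt_le, Rpower_gt0|].
    apply Rpower_le_base_neg; lra.
Qed.

(** At [p = 0] the beta integral is [/ a], and its upper bound is a positive multiple of
    [Gamma a]. *)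
Lemma Gamma_gt0 (a : R) : 0 < a -> 0 < Gamma a.
Proof.
  intros Ha; destruct (beta01_bounds a 0 Ha (Rle_refl 0)) as [H1 H2].
  rewrite beta01_0 in H1, H2 by exact Ha.
  assert (Hi := Rinv_0_lt_compat a Ha).
  assert (K : forall q, / a <= Rpower q (- a) * Gamma a -> 0 < Gamma a).
  { intros q Hq; apply Rmult_lt_reg_l with (Rpower q (- a)); [apply Rpower_gt0|lra]. }
  destruct (Rle_dec 1 a) as [H|H]; [apply (K (0 + 1))|apply (K (0 + a))].
  - apply H1, H.
  - apply H2; lra.
Qed.

Lemma is_lim_seq_shift_ratio (c : R) : 0 < c ->
  is_lim_seq (fun m => (INR m + 1) / (INR m + c)) 1.
Proof.
  intros Hc.
  apply (is_lim_seq_ext (fun m => 1 + (1 - c) * / (INR m + c))).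
  { intros m; assert (H := pos_INR m); field; lra. }
  replace (Finite 1) with (Finite (1 + (1 - c) * 0)) by (f_equal; ring).
  apply is_lim_seq_plus'; [apply is_lim_seq_const|].
  apply (is_lim_seq_scal_l (fun m => / (INR m + c)) (1 - c) (Finite 0)).
  replace (Finite 0) with (Rbar_inv p_infty) by reflexivity.
  apply is_lim_seq_inv; [|discriminate].
  apply (is_lim_seq_plus _ _ p_infty c); [apply is_lim_seq_INR|apply is_lim_seq_const|reflexivity].
Qed.

(** Squeeze between the two gamma bounds, which differ only in a constant added to [m] in the base.
    The scale is [m + 1] so that the base is positive for [m = 0] too. *)
Lemma is_lim_seq_beta01 (a p : R) : 0 < a -> 0 <= p ->
  is_lim_seq (fun m => Rpower (INR m + 1) a * beta01 a (p + INR m)) (Gamma a).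
Proof.
  intros Ha Hp.
  assert (E : forall c, 0 < c ->
    is_lim_seq (fun m => Rpower (INR m + 1) a * (Rpower (INR m + c) (- a) * Gamma a)) (Gamma a)).
  { intros c Hc.
    apply (is_lim_seq_ext (fun m => Gamma a * Rpower ((INR m + 1) / (INR m + c)) a)).
    { intros m; assert (H := pos_INR m); unfold Rdiv.
      rewrite <- Rpower_mult_distr by (try apply Rinv_0_lt_compat; lra).
      replace (Rpower (/ (INR m + c)) a) with (Rpower (INR m + c) (- a)); [ring|].
      unfold Rpower; rewrite ln_Rinv by lra; f_equal; ring. }
    replace (Finite (Gamma a)) with (Rbar_mult (Gamma a) (Finite (Rpower 1 a)))
      by (rewrite Rpower_base_1; simpl; f_equal; ring).
    apply is_lim_seq_scal_l.
    apply (is_lim_seq_continuous (fun x => Rpower x a)); [|apply is_lim_seq_shift_ratio, Hc].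
    apply continuity_pt_filterlim, continuous_Rpower; lra. }
  assert (P : forall m, 0 <= p + INR m) by (intros m; assert (H := pos_INR m); lra).
  assert (Q : forall m, 0 <= Rpower (INR m + 1) a) by (intros m; apply Rlt_le, Rpower_gt0).
  assert (H1 := E (p + 1)); assert (Ha' := E (p + a)).
  destruct (Rle_dec 1 a) as [Hle|Hle].
  - refine (is_lim_seq_le_le _ _ _ _ _ (Ha' _) (H1 _)); try lra.
    intros m; destruct (proj1 (beta01_bounds a (p + INR m) Ha (P m)) Hle) as [B1 B2].
    replace (INR m + (p + a)) with (p + INR m + a) by ring.
    replace (INR m + (p + 1)) with (p + INR m + 1) by ring.
    split; apply Rmult_le_compat_l; auto.
  - refine (is_lim_seq_le_le _ _ _ _ _ (H1 _) (Ha' _)); try lra.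
    assert (Hle' : a <= 1) by lra.
    intros m; destruct (proj2 (beta01_bounds a (p + INR m) Ha (P m)) Hle') as [B1 B2].
    replace (INR m + (p + a)) with (p + INR m + a) by ring.
    replace (INR m + (p + 1)) with (p + INR m + 1) by ring.
    split; apply Rmult_le_compat_l; auto.
Qed.

(** * Rising products and the identity between eigenvalues *)

(** The Pochhammer product [(x+1)...(x+n)], with the recursion of [theta_prod], whose eigenvalue on
    [x^m] it is at [x = m]. *)
Fixpoint rising (n : nat) (x : R) : R :=
  match n with O => 1 | S m => (INR (S m) + x) * rising m x end.

(** Both sides are [(x+1)...(x+n+1)]. *)
Lemma rising_shift (n : nat) (x : R) :
  (x + 1) * rising n (x + 1) = (INR n + x + 1) * rising n x.
Proof.
  induction n as [|n IH]; [simpl; ring|].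
  change (rising (S n) (x + 1)) with ((INR (S n) + (x + 1)) * rising n (x + 1)).
  change (rising (S n) x) with ((INR (S n) + x) * rising n x).
  transitivity ((INR (S n) + (x + 1)) * ((x + 1) * rising n (x + 1))); [ring|].
  rewrite IH, S_INR; ring.
Qed.

Lemma is_lim_seq_rising (n : nat) :
  is_lim_seq (fun m => rising n (INR m) / Rpower (INR m + 1) (INR n)) 1.
Proof.
  induction n as [|n IH].
  - apply (is_lim_seq_ext (fun _ => 1)); [|apply is_lim_seq_const].
    intros m; simpl; rewrite Rpower_O; [field|]; assert (H := pos_INR m); lra.
  - apply (is_lim_seq_ext (fun m => / ((INR m + 1) / (INR m + INR (S n))) *
      (rising n (INR m) / Rpower (INR m + 1) (INR n)))).
    + intros m; change (rising (S n) (INR m)) with ((INR (S n) + INR m) * rising n (INR m)).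
      assert (H := pos_INR m); assert (H' := pos_INR n); assert (P := Rpower_gt0 (INR m + 1) (INR n)).
      rewrite (S_INR n), Rpower_plus, Rpower_1 by lra; field; lra.
    + replace (Finite 1) with (Finite (/ 1 * 1)) by (f_equal; field).
      apply is_lim_seq_mult'; [|exact IH].
      apply (is_lim_seq_inv _ 1); [|injection; lra].
      apply is_lim_seq_shift_ratio; rewrite S_INR; assert (H' := pos_INR n); lra.
Qed.

Lemma is_lim_seq_constant_unique (u : nat -> R) (l : R) :
  (forall m, u (S m) = u m) -> is_lim_seq u l -> forall m, u m = l.
Proof.
  intros Hu Hl m.
  assert (H0 : forall k, u k = u 0%nat) by (intros k; induction k as [|k IH]; [|rewrite Hu]; auto).
  assert (H : is_lim_seq u (u 0%nat))
    by (apply (is_lim_seq_ext (fun _ => u 0%nat)); [auto|apply is_lim_seq_const]).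
  apply is_lim_seq_unique in H; apply is_lim_seq_unique in Hl; rewrite H0; congruence.
Qed.

(* The left-hand side does not depend on [m], so it equals its limit. *)
Lemma beta01_rising_integer (n m : nat) : (0 < n)%nat ->
  beta01 (INR n) (INR m) * rising n (INR m) = Gamma (INR n).
Proof.
  intros Hn; assert (Hn0 : 0 < INR n) by (apply lt_0_INR, Hn).
  revert m; apply is_lim_seq_constant_unique.
  - intros m; assert (H := pos_INR m); rewrite S_INR.
    assert (B := beta01_succ (INR n) (INR m) Hn0 H); assert (R := rising_shift n (INR m)).
    apply Rmult_eq_reg_l with ((INR n + INR m + 1) * (INR m + 1)); [|apply Rgt_not_eq; nra].
    transitivity (((INR n + INR m + 1) * beta01 (INR n) (INR m + 1)) * ((INR m + 1) * rising n (INR m + 1)));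
      [ring|]; rewrite B, R; ring.
  - assert (L1 := is_lim_seq_beta01 (INR n) 0 Hn0 (Rle_refl 0)).
    assert (L := is_lim_seq_mult' _ _ _ _ L1 (is_lim_seq_rising n)).
    rewrite Rmult_1_r in L; revert L; apply is_lim_seq_ext; intros m.
    rewrite Rplus_0_l; assert (P := Rpower_gt0 (INR m + 1) (INR n)); field; lra.
Qed.

(** From [m] to [m + 1] the three factors are multiplied by [(m+1)/(kappa+m+1)],
    [(kappa+m+1)/(n+m+1)] and [(n+m+1)/(m+1)], whose product is 1; the constant is then read off in
    the limit. The inequality [kappa < INR n] is strict because the second integral diverges at
    [kappa = INR n]. *)
Lemma beta01_rising (kappa : R) (n m : nat) : 0 < kappa -> kappa < INR n ->
  beta01 kappa (INR m) * beta01 (INR n - kappa) (kappa + INR m) * rising n (INR m)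
    = Gamma kappa * Gamma (INR n - kappa).
Proof.
  intros Hk Hn; set (d := INR n - kappa); assert (Hd : 0 < d) by (unfold d; lra).
  revert m; apply is_lim_seq_constant_unique.
  - intros m; assert (H := pos_INR m); rewrite S_INR.
    assert (Hkm : 0 <= kappa + INR m) by lra.
    assert (B1 := beta01_succ kappa (INR m) Hk H); assert (B2 := beta01_succ d (kappa + INR m) Hd Hkm).
    assert (R := rising_shift n (INR m)).
    replace (d + (kappa + INR m) + 1) with (INR n + INR m + 1) in B2 by (unfold d; ring).
    replace (kappa + (INR m + 1)) with (kappa + INR m + 1) by ring.
    assert (N := pos_INR n).
    apply Rmult_eq_reg_l with ((kappa + INR m + 1) * (INR n + INR m + 1) * (INR m + 1)).
    2:{ apply Rgt_not_eq; repeat apply Rmult_lt_0_compat; lra. }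
    transitivity (((kappa + INR m + 1) * beta01 kappa (INR m + 1)) *
       ((INR n + INR m + 1) * beta01 d (kappa + INR m + 1)) * ((INR m + 1) * rising n (INR m + 1)));
      [ring|]; rewrite B1, B2, R; ring.
  - assert (L1 := is_lim_seq_beta01 kappa 0 Hk (Rle_refl 0)).
    assert (L2 := is_lim_seq_beta01 d kappa Hd (Rlt_le _ _ Hk)).
    assert (L := is_lim_seq_mult' _ _ _ _ (is_lim_seq_mult' _ _ _ _ L1 L2) (is_lim_seq_rising n)).
    rewrite Rmult_1_r in L; revert L; apply is_lim_seq_ext; intros m.
    rewrite Rplus_0_l; assert (P := Rpower_gt0 (INR m + 1) kappa); assert (P' := Rpower_gt0 (INR m + 1) d).
    replace (INR n) with (kappa + d) by (unfold d; ring); rewrite Rpower_plus; field; lra.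
Qed.

(** * Polynomials and tame operators *)

Lemma Derive_n_Derive (f : R -> R) (k : nat) : Derive_n (Derive f) k = Derive_n f (S k).
Proof.
  apply functional_extensionality; intros x.
  rewrite <- Nat.add_1_r; exact (Derive_n_comp f k 1 x).
Qed.

Lemma smooth_Derive (f : R -> R) : smooth f -> smooth (Derive f).
Proof.
  intros Hf [|k] x; [exact I|]; simpl; rewrite Derive_n_Derive; exact (Hf (S (S k)) x).
Qed.

Lemma smooth_Derive_n (f : R -> R) (k : nat) : smooth f -> smooth (Derive_n f k).
Proof.
  intros Hf; induction k as [|k IH]; [exact Hf|exact (smooth_Derive _ IH)].
Qed.

Lemma smooth_ex_derive (f : R -> R) (x : R) : smooth f -> ex_derive f x.
Proof. intros Hf; exact (Hf 1%nat x). Qed.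

Lemma smooth_is_derive (f : R -> R) (x : R) : smooth f -> is_derive f x (Derive f x).
Proof. intros Hf; apply Derive_correct, smooth_ex_derive, Hf. Qed.

Lemma smooth_continuous (f : R -> R) (x : R) : smooth f -> continuous f x.
Proof.
  intros Hf; apply (ex_derive_continuous (V := R_NormedModule)), smooth_ex_derive, Hf.
Qed.

Lemma Derive_n_lin (f g : R -> R) (a b : R) (k : nat) : smooth f -> smooth g ->
  Derive_n (fun x => a * f x + b * g x) k = fun x => a * Derive_n f k x + b * Derive_n g k x.
Proof.
  intros Hf Hg; induction k as [|k IH]; [reflexivity|].
  apply functional_extensionality; intros x; simpl; rewrite IH.
  assert (H1 := smooth_ex_derive _ x (smooth_Derive_n f k Hf)).
  assert (H2 := smooth_ex_derive _ x (smooth_Derive_n g k Hg)).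
  rewrite Derive_plus by (apply ex_derive_scal; assumption).
  rewrite !Derive_scal; reflexivity.
Qed.

Lemma smooth_lin (f g : R -> R) (a b : R) : smooth f -> smooth g ->
  smooth (fun x => a * f x + b * g x).
Proof.
  intros Hf Hg [|k] x; [exact I|]; simpl; rewrite Derive_n_lin by assumption.
  apply (ex_derive_plus (V := R_NormedModule)); apply ex_derive_scal;
    apply smooth_ex_derive, smooth_Derive_n; assumption.
Qed.

Lemma continuous_bounded (f : R -> R) (a : R) : (forall x, continuous f x) ->
  exists C, 0 <= C /\ forall x, Rabs x <= a -> Rabs (f x) <= C.
Proof.
  intros Hf; destruct (Rle_lt_dec 0 a) as [Ha|Ha].
  - assert (Hc : forall c, - a <= c <= a -> continuity_pt (fun x => Rabs (f x)) c).
    { intros c _; apply (continuity_pt_comp f Rabs); [apply continuity_pt_filterlim, Hf|apply Rcontinuity_abs]. }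
    destruct (continuity_ab_maj (fun x => Rabs (f x)) (- a) a) as [M [HM _]]; [lra|exact Hc|].
    exists (Rabs (f M)); split; [apply Rabs_pos|].
    intros x Hx; apply HM, Rabs_le_between, Hx.
  - exists 0; split; [lra|]; intros x Hx; assert (H := Rabs_pos x); lra.
Qed.

Lemma Rabs_between (x y z a : R) : Rabs x <= a -> Rabs z <= a ->
  Rmin x z <= y <= Rmax x z -> Rabs y <= a.
Proof.
  intros Hx Hz [H1 H2]; apply Rabs_le_between in Hx; apply Rabs_le_between in Hz.
  apply Rabs_le_between; revert H1 H2; unfold Rmin, Rmax; destruct Rle_dec; lra.
Qed.

Lemma mean_value_bound (f df : R -> R) (a b M : R) :
  (forall y, is_derive f y (df y)) ->
  (forall y, Rmin a b <= y <= Rmax a b -> Rabs (df y) <= M) ->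
  Rabs (f b - f a) <= M * Rabs (b - a).
Proof.
  intros Hf HM; destruct (MVT_gen f a b df) as [c [Hc E]].
  - intros; apply Hf.
  - intros y _; apply continuity_pt_filterlim, (ex_derive_continuous (V := R_NormedModule)).
    exists (df y); apply Hf.
  - rewrite E, Rabs_mult; apply Rmult_le_compat_r; [apply Rabs_pos|apply HM, Hc].
Qed.

(** Generated by linear combinations rather than given by coefficients: induction then reduces a
    claim about a linear operator to monomials. *)
Inductive polynomial : (R -> R) -> Prop :=
| polynomial_monomial (m : nat) : polynomial (fun x => x ^ m)
| polynomial_lin (f g : R -> R) (a b : R) : polynomial f -> polynomial g ->
    polynomial (fun x => a * f x + b * g x).

Lemma polynomial_ext (f g : R -> R) : (forall x, f x = g x) -> polynomial f -> polynomial g.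
Proof. intros H Hf; replace g with f; [exact Hf|apply functional_extensionality, H]. Qed.

Lemma polynomial_const (c : R) : polynomial (fun _ => c).
Proof.
  apply (polynomial_ext (fun x => c * x ^ 0 + 0 * x ^ 0)); [intros x; simpl; ring|].
  apply polynomial_lin; apply polynomial_monomial.
Qed.

Lemma polynomial_mult (f g : R -> R) : polynomial f -> polynomial g ->
  polynomial (fun x => f x * g x).
Proof.
  intros Hf Hg; revert f Hf; induction Hg as [m|g1 g2 a b _ IH1 _ IH2]; intros f Hf.
  - induction Hf as [k|f1 f2 c d _ IH1 _ IH2].
    + apply (polynomial_ext (fun x => x ^ (k + m))); [intros x; apply pow_add|].
      apply polynomial_monomial.
    + apply (polynomial_ext (fun x => c * (f1 x * x ^ m) + d * (f2 x * x ^ m))); [intros; ring|].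
      apply polynomial_lin; assumption.
  - apply (polynomial_ext (fun x => a * (f x * g1 x) + b * (f x * g2 x))); [intros; ring|].
    apply polynomial_lin; auto.
Qed.

Lemma polynomial_plus (f g : R -> R) : polynomial f -> polynomial g ->
  polynomial (fun x => f x + g x).
Proof.
  intros Hf Hg; apply (polynomial_ext (fun x => 1 * f x + 1 * g x)); [intros; ring|].
  apply polynomial_lin; assumption.
Qed.

Lemma smooth_monomial (m : nat) : smooth (fun x => x ^ m).
Proof. intros k x; apply (ex_derive_n_ext (fun y => y ^ m)); [reflexivity|apply ex_derive_n_pow]. Qed.

Lemma smooth_polynomial (f : R -> R) : polynomial f -> smooth f.
Proof.
  induction 1 as [m|f g a b _ IHf _ IHg]; [apply smooth_monomial|apply smooth_lin; assumption].
Qed.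

Lemma polynomial_antiderivative (f : R -> R) : polynomial f ->
  exists F, polynomial F /\ forall x, is_derive F x (f x).
Proof.
  induction 1 as [m|f g a b _ [F [PF DF]] _ [G [PG DG]]].
  - exists (fun x => / INR (S m) * x ^ (S m) + 0 * x ^ (S m)); split.
    + apply polynomial_lin; apply polynomial_monomial.
    + intros x; assert (H := not_0_INR (S m) (Nat.neq_succ_0 m)).
      auto_derive; [exact I|]; simpl pred; field; exact H.
  - exists (fun x => a * F x + b * G x); split; [apply polynomial_lin; assumption|].
    intros x; apply (is_derive_plus (V := R_NormedModule));
      apply (is_derive_scal); [apply DF|apply DG].
Qed.

(** * Bernstein approximation *)

(* Expectation of [g] under the binomial law of parameters [n] and [x]:
   [bernstein n (fun k => f (INR k / INR n))] is the Bernstein polynomial of [f]. *)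
Fixpoint bernstein (n : nat) (g : nat -> R) (x : R) : R :=
  match n with
  | O => g O
  | S m => x * bernstein m (fun k => g (S k)) x + (1 - x) * bernstein m g x
  end.

Lemma bernstein_le (n : nat) (g h : nat -> R) (x : R) : 0 <= x <= 1 ->
  (forall k, (k <= n)%nat -> g k <= h k) -> bernstein n g x <= bernstein n h x.
Proof.
  intros Hx; revert g h; induction n as [|n IH]; intros g h H; [apply H; lia|].
  simpl; apply Rplus_le_compat; apply Rmult_le_compat_l; try lra; apply IH;
    intros k Hk; apply H; lia.
Qed.

Lemma bernstein_affine (n : nat) (g : nat -> R) (a b x : R) :
  bernstein n (fun k => a * g k + b) x = a * bernstein n g x + b.
Proof.
  revert g; induction n as [|n IH]; intros g; [reflexivity|].
  simpl; rewrite (IH (fun k => g (S k))), IH; ring.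
Qed.

(** Variance plus squared bias of the binomial law. The centre [c] is arbitrary because the
    recursion shifts [k], hence [c], by one. *)
Lemma bernstein_variance (n : nat) (c x : R) :
  bernstein n (fun k => (INR k - c) ^ 2) x = INR n * (x * (1 - x)) + (INR n * x - c) ^ 2.
Proof.
  revert c; induction n as [|n IH]; intros c; [simpl; ring|].
  change (bernstein (S n) (fun k => (INR k - c) ^ 2) x) with
    (x * bernstein n (fun k => (INR (S k) - c) ^ 2) x + (1 - x) * bernstein n (fun k => (INR k - c) ^ 2) x).
  replace (fun k => (INR (S k) - c) ^ 2) with (fun k => (INR k - (c - 1)) ^ 2).
  - rewrite !IH, S_INR; ring.
  - apply functional_extensionality; intros k; rewrite S_INR; ring.
Qed.

Lemma polynomial_bernstein (n : nat) (g : nat -> R) (a b : R) :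
  polynomial (fun x => bernstein n g (a * x + b)).
Proof.
  assert (A : forall c d, polynomial (fun x => c * x + d)).
  { intros c d; apply (polynomial_ext (fun x => c * x ^ 1 + d * x ^ 0)); [intros; simpl; ring|].
    apply polynomial_lin; apply polynomial_monomial. }
  revert g; induction n as [|n IH]; intros g; [exact (polynomial_const (g O))|].
  apply (polynomial_plus (fun x => (a * x + b) * bernstein n (fun k => g (S k)) (a * x + b))
    (fun x => (1 - (a * x + b)) * bernstein n g (a * x + b)));
    apply polynomial_mult; try apply IH; [apply A|].
  apply (polynomial_ext (fun x => - a * x + (1 - b))); [intros; ring|apply A].
Qed.

(* Bernstein's proof; AM-GM gives [M |d| <= eps / 2 + M^2 d^2 / (2 eps)] with [d = k / n - t]. *)
Lemma lipschitz_approximation (f : R -> R) (a L eps : R) : 0 < a -> 0 < eps ->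
  (forall x y, Rabs x <= a -> Rabs y <= a -> Rabs (f y - f x) <= L * Rabs (y - x)) ->
  exists p, polynomial p /\ forall x, Rabs x <= a -> Rabs (f x - p x) <= eps.
Proof.
  intros Ha He HL.
  (* The Lipschitz constant after [[-a,a]] is rescaled to [[0,1]]. *)
  set (M := L * (2 * a)).
  (* The variance contributes at most [M^2 / (2 eps n)], which this [n] brings below [eps / 2]. *)
  destruct (INR_unbounded (M ^ 2 / eps ^ 2)) as [n Hn].
  assert (HM2 : 0 <= M ^ 2) by apply pow2_ge_0.
  assert (He2 : 0 < eps ^ 2) by (apply pow_lt; exact He).
  assert (Hn0 : 0 < INR n).
  { apply Rle_lt_trans with (2 := Hn); apply Rdiv_le_0_compat; lra. }
  set (g := fun k => f (- a + 2 * a * (INR k / INR n))).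
  exists (fun x => bernstein n g (/ (2 * a) * x + / 2)); split; [apply polynomial_bernstein|].
  intros x Hx; set (t := / (2 * a) * x + / 2).
  assert (Et : x = - a + 2 * a * t) by (unfold t; field; lra).
  assert (Ht : 0 <= t <= 1) by (apply Rabs_le_between in Hx; split; nra).
  set (K := M ^ 2 / (2 * eps * INR n ^ 2)).
  assert (B : forall k, (k <= n)%nat ->
    Rabs (g k - f x) <= eps / 2 + K * (INR k - INR n * t) ^ 2).
  { intros k Hk; set (d := INR k / INR n - t).
    assert (Hkn : 0 <= INR k / INR n <= 1).
    { apply le_INR in Hk; assert (H := pos_INR k); split.
      - apply Rdiv_le_0_compat; lra.
      - apply Rle_div_l; lra. }
    assert (Hy : Rabs (- a + 2 * a * (INR k / INR n)) <= a) by (apply Rabs_le_between; nra).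
    assert (H := HL x _ Hx Hy); fold (g k) in H.
    replace (- a + 2 * a * (INR k / INR n) - x) with (2 * a * d) in H by (rewrite Et; unfold d; ring).
    rewrite Rabs_mult, (Rabs_pos_eq (2 * a)) in H by lra.
    apply Rle_trans with (1 := H).
    replace (K * (INR k - INR n * t) ^ 2) with (M ^ 2 * d ^ 2 / (2 * eps))
      by (unfold K, d; field; lra).
    rewrite <- (pow2_abs d).
    replace (L * (2 * a * Rabs d)) with (M * Rabs d) by (unfold M; ring).
    apply Rmult_le_reg_l with (2 * eps); [lra|].
    replace (2 * eps * (eps / 2 + M ^ 2 * Rabs d ^ 2 / (2 * eps)))
      with (eps ^ 2 + (M * Rabs d) ^ 2) by (field; lra).
    assert (H2 := pow2_ge_0 (eps - M * Rabs d)); nra. }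
  assert (V : K * (INR n * (t * (1 - t)) + (INR n * t - INR n * t) ^ 2) <= eps / 2).
  { replace (K * (INR n * (t * (1 - t)) + (INR n * t - INR n * t) ^ 2))
      with ((M ^ 2 / eps ^ 2) * (t * (1 - t)) * (eps / (2 * INR n))) by (unfold K; field; lra).
    apply Rle_trans with (INR n * 1 * (eps / (2 * INR n))); [|right; field; lra].
    apply Rmult_le_compat_r; [apply Rdiv_le_0_compat; lra|].
    apply Rmult_le_compat; try nra; apply Rdiv_le_0_compat; lra. }
  assert (U1 : bernstein n g t <= bernstein n (fun k => K * (INR k - INR n * t) ^ 2 + (f x + eps / 2)) t).
  { apply bernstein_le; [exact Ht|]; intros k Hk; specialize (B k Hk); apply Rabs_le_between in B; lra. }
  assert (U2 : bernstein n (fun k => - K * (INR k - INR n * t) ^ 2 + (f x - eps / 2)) t <= bernstein n g t).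
  { apply bernstein_le; [exact Ht|]; intros k Hk; specialize (B k Hk); apply Rabs_le_between in B; lra. }
  rewrite bernstein_affine, bernstein_variance in U1, U2.
  apply Rabs_le_between; lra.
Qed.

Lemma polynomial_dense (N : nat) (f : R -> R) (a eps : R) : smooth f -> 0 < a -> 0 < eps ->
  exists p, polynomial p /\ forall j x, (j <= N)%nat -> Rabs x <= a ->
    Rabs (Derive_n f j x - Derive_n p j x) <= eps.
Proof.
  intros Hf Ha; revert f Hf eps; induction N as [|N IH]; intros f Hf eps He.
  - destruct (continuous_bounded (Derive f) a) as [L [HL0 HL]].
    { intros x; apply smooth_continuous, smooth_Derive, Hf. }
    destruct (lipschitz_approximation f a L eps Ha He) as [p [Pp Hp]].
    { intros x y Hx Hy; apply (mean_value_bound f (Derive f)).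
      - intros z; apply smooth_is_derive, Hf.
      - intros z Hz; apply HL, (Rabs_between x z y); assumption. }
    exists p; split; [exact Pp|]; intros j x Hj Hx.
    replace j with 0%nat by lia; apply Hp, Hx.
  (* Integrating from 0 multiplies the error by at most [a]; dividing by [1 + a] covers this as well
     as the derivatives, whose error is unchanged. *)
  - assert (He' : 0 < eps / (1 + a)) by (apply Rdiv_lt_0_compat; lra).
    destruct (IH (Derive f) (smooth_Derive f Hf) _ He') as [q [Pq Hq]].
    destruct (polynomial_antiderivative q Pq) as [Q [PQ DQ]].
    assert (Dp : forall x, is_derive (fun x => Q x + (f 0 - Q 0)) x (q x)).
    { intros x; replace (q x) with (q x + 0) by ring.
      apply (is_derive_plus (V := R_NormedModule)); [apply DQ|apply (is_derive_const (V := R_NormedModule))]. }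
    assert (Eps : eps / (1 + a) * (1 + a) = eps) by (field; lra).
    exists (fun x => Q x + (f 0 - Q 0)); split.
    + apply polynomial_plus; [exact PQ|apply polynomial_const].
    + intros [|j] x Hj Hx.
      * assert (Dd : forall y, is_derive (fun y => f y - (Q y + (f 0 - Q 0))) y (Derive f y - q y)).
        { intros y; apply (is_derive_minus (V := R_NormedModule)); [apply smooth_is_derive, Hf|apply Dp]. }
        assert (H := mean_value_bound _ _ 0 x (eps / (1 + a)) Dd); simpl in H |- *.
        replace (f x - (Q x + (f 0 - Q 0)) - (f 0 - (Q 0 + (f 0 - Q 0))))
          with (f x - (Q x + (f 0 - Q 0))) in H by ring.
        rewrite Rminus_0_r in H.
        apply Rle_trans with (eps / (1 + a) * Rabs x).
        -- apply H; intros y Hy; apply (Hq 0%nat y); [lia|].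
           apply (Rabs_between 0 y x); [rewrite Rabs_R0; lra|exact Hx|exact Hy].
        -- nra.
      * rewrite <- !Derive_n_Derive.
        replace (Derive (fun x => Q x + (f 0 - Q 0))) with q
          by (apply functional_extensionality; intros y; symmetry; apply is_derive_unique, Dp).
        apply Rle_trans with (eps / (1 + a)); [apply Hq; [lia|exact Hx]|].
        nra.
Qed.

(** * Tame operators: continuity and extension from polynomials *)

Definition linear_on_smooth (T : (R -> R) -> R -> R) : Prop :=
  forall f g a b, smooth f -> smooth g ->
    T (fun x => a * f x + b * g x) = fun x => a * T f x + b * T g x.

(** A bound on the seminorm in terms of reals, free of the extended supremum. *)
Definition bounded_derivatives (f : R -> R) (m : nat) (a A : R) : Prop :=
  forall j x, (j <= m)%nat -> Rabs x <= a -> Rabs (Derive_n f j x) <= A.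

(** The radius [a] is the same on both sides while the order may rise from [k] to [m]; this form is
    stable under composition. *)
Definition tame (T : (R -> R) -> R -> R) : Prop :=
  maps_smooth T /\ linear_on_smooth T /\
  forall k a, 0 < a -> exists m C, 0 <= C /\
    forall f A, smooth f -> bounded_derivatives f m a A -> bounded_derivatives (T f) k a (C * A).

Lemma bounded_derivatives_nonneg (f : R -> R) (m : nat) (a A : R) :
  0 < a -> bounded_derivatives f m a A -> 0 <= A.
Proof.
  intros Ha H; apply Rle_trans with (2 := H 0%nat 0 (Nat.le_0_l m) ltac:(rewrite Rabs_R0; lra)).
  apply Rabs_pos.
Qed.

Lemma bounded_derivatives_le (f : R -> R) (m m' : nat) (a A : R) :
  (m <= m')%nat -> bounded_derivatives f m' a A -> bounded_derivatives f m a A.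
Proof. intros Hm H j x Hj; apply H; lia. Qed.

(** Estimating one derivative at a time is enough: the finitely many orders up to [k] are merged by
    the maximum of the orders and the sum of the constants. *)
Lemma tame_intro (T : (R -> R) -> R -> R) :
  maps_smooth T -> linear_on_smooth T ->
  (forall k a, 0 < a -> exists m C, 0 <= C /\
    forall f A, smooth f -> bounded_derivatives f m a A ->
      forall x, Rabs x <= a -> Rabs (Derive_n (T f) k x) <= C * A) ->
  tame T.
Proof.
  intros Hs Hl HB; split; [exact Hs|split; [exact Hl|]]; intros k a Ha.
  induction k as [|k [m [C [HC IH]]]].
  - destruct (HB 0%nat a Ha) as [m [C [HC H]]]; exists m, C; split; [exact HC|].
    intros f A Sf Bf j x Hj Hx; replace j with 0%nat by lia; exact (H f A Sf Bf x Hx).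
  - destruct (HB (S k) a Ha) as [m' [C' [HC' H]]]; exists (max m m'), (C + C'); split; [lra|].
    intros f A Sf Bf j x Hj Hx.
    assert (HA := bounded_derivatives_nonneg f _ a A Ha Bf).
    destruct (Nat.eq_dec j (S k)) as [->|Hjk].
    + apply Rle_trans with (C' * A); [|nra].
      apply (H f A Sf); [|exact Hx]; revert Bf; apply bounded_derivatives_le; lia.
    + apply Rle_trans with (C * A); [|nra].
      apply (IH f A Sf); [revert Bf; apply bounded_derivatives_le|..]; try lia; exact Hx.
Qed.

Lemma tame_id : tame (fun f => f).
Proof.
  split; [intros f Hf; exact Hf|split; [intros f g a b _ _; reflexivity|]].
  intros k a _; exists k, 1; split; [lra|]; intros f A _ H; rewrite Rmult_1_l; exact H.
Qed.

Lemma tame_comp (S T : (R -> R) -> R -> R) : tame S -> tame T -> tame (fun f => S (T f)).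
Proof.
  intros [HS1 [HS2 HS3]] [HT1 [HT2 HT3]]; split; [|split].
  - intros f Hf; apply HS1, HT1, Hf.
  - intros f g a b Hf Hg; rewrite HT2, HS2 by auto; reflexivity.
  - intros k a Ha; destruct (HS3 k a Ha) as [m [C [HC H]]].
    destruct (HT3 m a Ha) as [m' [C' [HC' H']]]; exists m', (C * C'); split; [nra|].
    intros f A Sf Bf; rewrite Rmult_assoc; auto.
Qed.

Lemma tame_sub (T : (R -> R) -> R -> R) (f g : R -> R) : tame T -> smooth f -> smooth g ->
  T (fun x => f x - g x) = fun x => T f x - T g x.
Proof.
  intros [_ [HT _]] Hf Hg.
  assert (H := HT f g 1 (-1) Hf Hg).
  replace (fun x => f x - g x) with (fun x => 1 * f x + -1 * g x)
    by (apply functional_extensionality; intros x; ring).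
  rewrite H; apply functional_extensionality; intros x; ring.
Qed.

Lemma smooth_sub (f g : R -> R) : smooth f -> smooth g -> smooth (fun x => f x - g x).
Proof.
  intros Hf Hg; replace (fun x => f x - g x) with (fun x => 1 * f x + -1 * g x)
    by (apply functional_extensionality; intros x; ring).
  apply smooth_lin; assumption.
Qed.

Lemma tame_continuous (T : (R -> R) -> R -> R) : tame T -> Cinf_continuous T.
Proof.
  intros HT; assert (HT' := HT); destruct HT' as [HT1 [_ HT3]].
  intros U HU f Sf Uf; destruct (HU (T f) (HT1 f Sf) Uf) as [n [a [eps [Ha [He H]]]]].
  destruct (HT3 n a Ha) as [m [C [HC HB]]].
  (* [C + 1] guards against [C = 0]; the factor 2 leaves room because pointwise bounds only give a
     non-strict bound on the supremum. *)
  assert (He' : 0 < eps / (2 * (C + 1))) by (apply Rdiv_lt_0_compat; lra).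
  exists m, a, (eps / (2 * (C + 1))); split; [exact Ha|split; [exact He'|]].
  intros g Sg Hg; apply (H (T g) (HT1 g Sg)).
  assert (B : bounded_derivatives (fun x => g x - f x) m a (eps / (2 * (C + 1)))).
  { intros j x Hj Hx.
    assert (L := proj1 (Lub_Rbar_correct (fun y => exists (k : nat) (x : R),
      (k <= m)%nat /\ Rabs x <= a /\ y = Rabs (Derive_n (fun x => g x - f x) k x)))
      _ (ex_intro _ j (ex_intro _ x (conj Hj (conj Hx eq_refl))))).
    apply Rlt_le; exact (Rbar_le_lt_trans _ _ _ L Hg). }
  apply HB in B; [|apply smooth_sub; assumption].
  rewrite (tame_sub T g f HT Sg Sf) in B.
  apply Rbar_le_lt_trans with (Finite (eps / 2)); [|simpl; lra].
  apply (proj2 (Lub_Rbar_correct _)).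
  intros y [k [x [Hk [Hx ->]]]]; simpl.
  apply Rle_trans with (1 := B k x Hk Hx).
  replace (eps / 2) with ((C + 1) * (eps / (2 * (C + 1)))) by (field; lra); nra.
Qed.

(** For a polynomial [p] one has [T f - f = T (f - p) - (f - p)], and both terms are small at [x]
    once [p] is close to [f] with [m] derivatives on an interval containing [x]. *)
Lemma tame_eq_id (T : (R -> R) -> R -> R) : tame T ->
  (forall m, T (fun x => x ^ m) = fun x => x ^ m) -> forall f, smooth f -> T f = f.
Proof.
  intros HT Hm; assert (HT' := HT); destruct HT' as [_ [HT2 HT3]].
  assert (P : forall p, polynomial p -> T p = p).
  { induction 1 as [m|p q a b Pp IHp Pq IHq]; [apply Hm|].
    rewrite HT2 by (apply smooth_polynomial; assumption); rewrite IHp, IHq; reflexivity. }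
  intros f Sf; apply functional_extensionality; intros x.
  set (a := Rabs x + 1); assert (Ha : 0 < a) by (unfold a; assert (H := Rabs_pos x); lra).
  assert (Hx : Rabs x <= a) by (unfold a; lra).
  destruct (HT3 0%nat a Ha) as [m [C [HC HB]]].
  apply cond_eq; intros eps He.
  assert (He' : 0 < eps / (2 * (C + 1))) by (apply Rdiv_lt_0_compat; lra).
  destruct (polynomial_dense m f a _ Sf Ha He') as [p [Pp Hp]].
  assert (Sp := smooth_polynomial p Pp).
  assert (B : bounded_derivatives (fun x => f x - p x) m a (eps / (2 * (C + 1)))).
  { intros j y Hj Hy.
    replace (fun x => f x - p x) with (fun x => 1 * f x + -1 * p x)
      by (apply functional_extensionality; intros z; ring).
    rewrite Derive_n_lin by assumption.
    replace (1 * _ + _) with (Derive_n f j y - Derive_n p j y) by ring; auto. }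
  apply HB in B; [|apply smooth_sub; assumption].
  rewrite (tame_sub T f p HT Sf Sp) in B.
  assert (B0 := B 0%nat x (le_n 0) Hx); simpl in B0; rewrite (P p Pp) in B0.
  assert (B1 := Hp 0%nat x (Nat.le_0_l m) Hx); simpl in B1.
  replace (T f x - f x) with ((T f x - p x) - (f x - p x)) by ring.
  apply Rle_lt_trans with (1 := Rabs_triang _ _); rewrite Rabs_Ropp.
  apply Rle_lt_trans with ((C + 1) * (eps / (2 * (C + 1)))); [lra|].
  replace ((C + 1) * (eps / (2 * (C + 1)))) with (eps / 2) by (field; lra); lra.
Qed.

(** * Dilation means and the Euler operator *)

(** Conditions on the open interval only, so that an integrable singularity at an end is allowed. *)
Definition weight (w : R -> R) : Prop :=
  (forall t, 0 < t < 1 -> continuous w t) /\ (forall t, 0 < t < 1 -> 0 <= w t) /\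
  ex_RInt_gen w (at_right 0) (at_left 1).

Definition dilation_mean (w f : R -> R) (x : R) : R := RInt01 (fun t => w t * f (t * x)).

Lemma Rabs_dilation_le (t x a : R) : 0 < t < 1 -> Rabs x <= a -> Rabs (t * x) <= a.
Proof.
  intros Ht Hx; rewrite Rabs_mult, (Rabs_pos_eq t) by lra; assert (H := Rabs_pos x); nra.
Qed.

Lemma weight_mult_bounded (w g : R -> R) (C : R) : weight w ->
  (forall t, 0 < t < 1 -> continuous g t) -> (forall t, 0 < t < 1 -> Rabs (g t) <= C) ->
  ex_RInt_gen (fun t => w t * g t) (at_right 0) (at_left 1).
Proof.
  intros [Hw1 [Hw2 [l Hl]]] Hg HC.
  apply (ex_RInt_gen_dominated _ _ _ _ (fun t => C * w t) joins_01).
  - intros t Ht; apply (continuous_mult (K := R_AbsRing) w g); auto.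
  - intros t Ht; apply (continuous_scal_r (V := R_NormedModule) C w), Hw1, Ht.
  - intros t Ht; rewrite Rabs_mult, (Rabs_pos_eq (w t)) by auto.
    assert (H1 := Hw2 t Ht); assert (H2 := HC t Ht); nra.
  - exists (C * l); exact (is_RInt_gen_scal w C l Hl).
Qed.

Lemma weight_pow (w : R -> R) (k : nat) : weight w -> weight (fun t => t ^ k * w t).
Proof.
  intros Hw; assert (Hw' := Hw); destruct Hw' as [Hw1 [Hw2 Hw3]].
  assert (C : forall t, continuous (fun t => t ^ k) t)
    by (intros t; apply smooth_continuous, smooth_monomial).
  split; [|split].
  - intros t Ht; apply (continuous_mult (K := R_AbsRing) (fun t => t ^ k) w); auto.
  - intros t Ht; apply Rmult_le_pos; [apply pow_le; lra|auto].
  - replace (fun t => t ^ k * w t) with (fun t => w t * t ^ k)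
      by (apply functional_extensionality; intros t; ring).
    apply (weight_mult_bounded w (fun t => t ^ k) 1 Hw); [auto|].
    intros t Ht; rewrite Rabs_pos_eq by (apply pow_le; lra).
    rewrite <- (pow1 k); apply pow_incr; lra.
Qed.

Lemma dilation_mean_correct (w f : R -> R) (x : R) : weight w -> (forall y, continuous f y) ->
  is_RInt01 (fun t => w t * f (t * x)) (dilation_mean w f x).
Proof.
  intros Hw Hf; apply RInt01_correct.
  destruct (continuous_bounded f (Rabs x) Hf) as [C [_ HC]].
  apply (weight_mult_bounded w (fun t => f (t * x)) C Hw).
  - intros t Ht; apply (continuous_comp (fun t => t * x) f); [|apply Hf].
    apply (ex_derive_continuous (V := R_NormedModule)); auto_derive; exact I.
  - intros t Ht; apply HC, Rabs_dilation_le; [exact Ht|lra].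
Qed.

Lemma weight_bound (w h : R -> R) (C l : R) : weight w ->
  (forall t, 0 < t < 1 -> Rabs (h t) <= C) -> is_RInt01 (fun t => w t * h t) l ->
  Rabs l <= C * RInt01 w.
Proof.
  intros [Hw1 [Hw2 Hw3]] HC Hl.
  assert (K := is_RInt_gen_scal _ C _ (RInt01_correct w Hw3)).
  refine (is_RInt_gen_abs_le _ _ _ _ _ _ _ joins_01 ordered_ends_01 _ Hl K).
  intros t Ht; rewrite Rabs_mult, (Rabs_pos_eq (w t)) by auto.
  unfold scal; simpl; unfold mult; simpl; assert (H1 := Hw2 t Ht); assert (H2 := HC t Ht); nra.
Qed.

Lemma weight_mass_nonneg (w : R -> R) : weight w -> 0 <= RInt01 w.
Proof.
  intros Hw; assert (H := weight_bound w (fun _ => 1) 1 (RInt01 w) Hw).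
  rewrite Rmult_1_l in H; apply Rle_trans with (1 := Rabs_pos (RInt01 w)), H.
  - intros; rewrite Rabs_R1; lra.
  - apply (is_RInt_gen_ext_on _ _ _ w _ _ joins_01); [intros; ring|].
    apply RInt01_correct, Hw.
Qed.

Lemma dilation_mean_bound (w f : R -> R) (a A x : R) : weight w -> (forall y, continuous f y) ->
  (forall y, Rabs y <= a -> Rabs (f y) <= A) -> Rabs x <= a ->
  Rabs (dilation_mean w f x) <= A * RInt01 w.
Proof.
  intros Hw Hf HA Hx.
  apply (weight_bound w (fun t => f (t * x)) A _ Hw); [|apply dilation_mean_correct; assumption].
  intros t Ht; apply HA, Rabs_dilation_le; assumption.
Qed.

(** A remainder bound uniform in [u], so that it can be integrated against a weight: differentiation
    under the integral then needs no convergence theorem. *)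
Lemma taylor_bound (f : R -> R) (r : R) : smooth f ->
  exists C, 0 <= C /\ forall u v, Rabs u <= r -> Rabs (u + v) <= r ->
    Rabs (f (u + v) - f u - v * Derive f u) <= C * v ^ 2.
Proof.
  intros Sf; assert (Sf' := smooth_Derive f Sf).
  destruct (continuous_bounded (Derive (Derive f)) r) as [C [HC0 HC]].
  { intros x; apply smooth_continuous, smooth_Derive, Sf'. }
  exists C; split; [exact HC0|]; intros u v Hu Hv.
  (* The mean value bound is used twice: on [f] minus its linear part at [u], then on [Derive f] to
     bound the resulting slope by [C |v|]. *)
  assert (D : forall y, is_derive (fun y => f y - Derive f u * y) y (Derive f y - Derive f u)).
  { intros y; apply (is_derive_minus (V := R_NormedModule)); [apply smooth_is_derive, Sf|].
    auto_derive; [exact I|ring]. }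
  assert (H := mean_value_bound _ _ u (u + v) (C * Rabs v) D); cbv beta in H.
  replace (f (u + v) - Derive f u * (u + v) - (f u - Derive f u * u))
    with (f (u + v) - f u - v * Derive f u) in H by ring.
  replace (u + v - u) with v in H by ring.
  replace (C * v ^ 2) with (C * Rabs v * Rabs v) by (rewrite <- pow2_abs; ring).
  apply H; intros y Hy.
  apply Rle_trans with (C * Rabs (y - u)).
  - apply (mean_value_bound (Derive f) (Derive (Derive f))).
    + intros z; apply smooth_is_derive, Sf'.
    + intros z Hz; apply HC, (Rabs_between u z y); [exact Hu| |exact Hz].
      exact (Rabs_between u y (u + v) r Hu Hv Hy).
  - apply Rmult_le_compat_l; [exact HC0|].
    revert Hy; unfold Rmin, Rmax; destruct Rle_dec; intros Hy;
      unfold Rabs; repeat destruct Rcase_abs; lra.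
Qed.

Lemma is_derive_quadratic_remainder (F : R -> R) (x l K : R) : 0 <= K ->
  (forall h, Rabs h <= 1 -> Rabs (F (x + h) - F x - h * l) <= K * h ^ 2) -> is_derive F x l.
Proof.
  intros HK H; apply is_derive_Reals; intros eps He.
  assert (Hd : 0 < Rmin 1 (eps / (K + 1))) by (apply Rmin_pos; [lra|apply Rdiv_lt_0_compat; lra]).
  exists (mkposreal _ Hd); intros h Hh0 Hh; simpl in Hh.
  assert (H1 := Rlt_le_trans _ _ _ Hh (Rmin_l _ _)); assert (H2 := Rlt_le_trans _ _ _ Hh (Rmin_r _ _)).
  assert (H3 := H h (Rlt_le _ _ H1)); assert (Hp := Rabs_pos_lt h Hh0).
  replace ((F (x + h) - F x) / h - l) with ((F (x + h) - F x - h * l) / h) by (field; exact Hh0).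
  unfold Rdiv; rewrite Rabs_mult, Rabs_inv.
  apply Rle_lt_trans with (K * Rabs h).
  - rewrite <- pow2_abs in H3.
    apply Rle_div_l; [exact Hp|]; lra.
  - apply Rle_lt_trans with ((K + 1) * Rabs h); [nra|].
    apply Rmult_lt_compat_l with (r := K + 1) in H2; [|lra].
    replace ((K + 1) * (eps / (K + 1))) with eps in H2 by (field; lra); exact H2.
Qed.

Lemma is_derive_dilation_mean (w f : R -> R) (x : R) : weight w -> smooth f ->
  is_derive (dilation_mean w f) x (dilation_mean (fun t => t * w t) (Derive f) x).
Proof.
  intros Hw Sf; assert (Cf := fun y => smooth_continuous f y Sf).
  assert (Cf' := fun y => smooth_continuous _ y (smooth_Derive f Sf)).
  assert (Hw1 : weight (fun t => t * w t)).
  { replace (fun t => t * w t) with (fun t => t ^ 1 * w t)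
      by (apply functional_extensionality; intros; ring); apply weight_pow, Hw. }
  (* For [|h| <= 1] this radius contains every [t x] and [t (x + h)]. *)
  destruct (taylor_bound f (Rabs x + 1) Sf) as [C [HC0 HC]].
  apply (is_derive_quadratic_remainder _ _ _ (C * RInt01 w)).
  { apply Rmult_le_pos; [exact HC0|apply weight_mass_nonneg, Hw]. }
  intros h Hh.
  assert (I1 := dilation_mean_correct w f (x + h) Hw Cf).
  assert (I0 := dilation_mean_correct w f x Hw Cf).
  assert (I2 := dilation_mean_correct _ _ x Hw1 Cf').
  assert (J := is_RInt_gen_minus _ _ _ _ (is_RInt_gen_minus _ _ _ _ I1 I0) (is_RInt_gen_scal _ h _ I2)).
  replace (C * RInt01 w * h ^ 2) with (C * h ^ 2 * RInt01 w) by ring.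
  apply (weight_bound w (fun t => f (t * x + t * h) - f (t * x) - (t * h) * Derive f (t * x)) _ _ Hw).
  - intros t Ht; apply Rle_trans with (C * (t * h) ^ 2).
    + apply HC.
      * apply Rabs_dilation_le; [exact Ht|lra].
      * replace (t * x + t * h) with (t * (x + h)) by ring; apply Rabs_dilation_le; [exact Ht|].
        apply Rle_trans with (1 := Rabs_triang x h); lra.
    + apply Rmult_le_compat_l; [exact HC0|].
      rewrite Rpow_mult_distr; assert (H := pow2_ge_0 h).
      assert (t ^ 2 <= 1) by nra; nra.
  - refine (is_RInt_gen_ext_on _ _ _ _ _ _ joins_01 _ J); intros t Ht.
    unfold minus, plus, opp, scal; simpl; unfold mult; simpl.
    replace (t * (x + h)) with (t * x + t * h) by ring; ring.
Qed.

Lemma Derive_n_dilation_mean (w f : R -> R) (k : nat) : weight w -> smooth f ->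
  Derive_n (dilation_mean w f) k = dilation_mean (fun t => t ^ k * w t) (Derive_n f k).
Proof.
  intros Hw Sf; induction k as [|k IH].
  - replace (fun t => t ^ 0 * w t) with w by (apply functional_extensionality; intros t; simpl; ring).
    reflexivity.
  - apply functional_extensionality; intros x; simpl Derive_n; rewrite IH.
    apply is_derive_unique.
    replace (fun t => t ^ S k * w t) with (fun t => t * (t ^ k * w t))
      by (apply functional_extensionality; intros t; simpl; ring).
    apply (is_derive_dilation_mean (fun t => t ^ k * w t)); [apply weight_pow, Hw|apply smooth_Derive_n, Sf].
Qed.

Lemma dilation_mean_lin (w f g : R -> R) (a b x : R) : weight w ->
  (forall y, continuous f y) -> (forall y, continuous g y) ->
  dilation_mean w (fun y => a * f y + b * g y) x = a * dilation_mean w f x + b * dilation_mean w g x.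
Proof.
  intros Hw Hf Hg; apply RInt01_unique.
  assert (If := is_RInt_gen_scal _ a _ (dilation_mean_correct w f x Hw Hf)).
  assert (Ig := is_RInt_gen_scal _ b _ (dilation_mean_correct w g x Hw Hg)).
  refine (is_RInt_gen_ext_on _ _ _ _ _ _ joins_01 _ (is_RInt_gen_plus _ _ _ _ If Ig)); intros t Ht.
  unfold plus, scal; simpl; unfold mult; simpl; ring.
Qed.

Lemma smooth_dilation_mean (w f : R -> R) : weight w -> smooth f -> smooth (dilation_mean w f).
Proof.
  intros Hw Sf [|k] x; [exact I|]; simpl; rewrite Derive_n_dilation_mean by assumption.
  eexists; apply is_derive_dilation_mean; [apply weight_pow, Hw|apply smooth_Derive_n, Sf].
Qed.

Lemma tame_dilation_mean (w : R -> R) (c : R) : weight w ->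
  tame (fun f x => c * dilation_mean w f x).
Proof.
  intros Hw; assert (E : forall f, (fun x => c * dilation_mean w f x)
    = fun x => c * dilation_mean w f x + 0 * dilation_mean w f x)
    by (intros f; apply functional_extensionality; intros x; ring).
  apply tame_intro.
  - intros f Sf; rewrite E; apply smooth_lin; apply smooth_dilation_mean; assumption.
  - intros f g a b Sf Sg; apply functional_extensionality; intros x.
    rewrite dilation_mean_lin by (try intros y; try apply smooth_continuous; assumption); ring.
  - intros k a Ha; exists k, (Rabs c * RInt01 (fun t => t ^ k * w t)).
    assert (Hk := weight_pow w k Hw); split.
    + apply Rmult_le_pos; [apply Rabs_pos|apply weight_mass_nonneg, Hk].
    + intros f A Sf Bf x Hx; rewrite Derive_n_scal_l, Rabs_mult, Rmult_assoc.
      apply Rmult_le_compat_l; [apply Rabs_pos|].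
      rewrite Derive_n_dilation_mean, Rmult_comm by assumption.
      apply (dilation_mean_bound _ _ a); [exact Hk| | |exact Hx].
      * intros y; apply smooth_continuous, smooth_Derive_n, Sf.
      * intros y Hy; apply Bf; [lia|exact Hy].
Qed.

Lemma dilation_mean_monomial (w : R -> R) (m : nat) (l : R) :
  is_RInt01 (fun t => w t * t ^ m) l -> dilation_mean w (fun x => x ^ m) = fun x => l * x ^ m.
Proof.
  intros Hl; apply functional_extensionality; intros x; apply RInt01_unique.
  assert (H := is_RInt_gen_scal _ (x ^ m) _ Hl).
  replace (l * x ^ m) with (scal (x ^ m) l) by (unfold scal; simpl; unfold mult; simpl; ring).
  revert H; apply (is_RInt_gen_ext_on _ _ _ _ _ _ joins_01); intros t Ht.
  unfold scal; simpl; unfold mult; simpl; rewrite Rpow_mult_distr; ring.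
Qed.

(** * The Euler operator *)

Definition euler_step (c : R) (g : R -> R) : R -> R := fun x => c * g x + x * Derive g x.

(** The commutation of [d/dx] with [c + x d/dx], which raises [c] by one; iterated, it controls all
    derivatives. *)
Lemma is_derive_euler_step (c : R) (g : R -> R) (x : R) : smooth g ->
  is_derive (euler_step c g) x (euler_step (c + 1) (Derive g) x).
Proof.
  intros Sg; unfold euler_step.
  assert (D1 := smooth_is_derive g x Sg).
  assert (D2 := smooth_is_derive _ x (smooth_Derive g Sg)).
  replace ((c + 1) * Derive g x + x * Derive (Derive g) x)
    with (c * Derive g x + (1 * Derive g x + x * Derive (Derive g) x)) by ring.
  apply (is_derive_plus (V := R_NormedModule)); [apply is_derive_scal, D1|].
  apply (is_derive_mult (K := R_AbsRing) (fun x => x)); [apply (is_derive_id (K := R_AbsRing))|exact D2|].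
  intros; apply Rmult_comm.
Qed.

Lemma Derive_n_euler_step (c : R) (g : R -> R) (k : nat) : smooth g ->
  Derive_n (euler_step c g) k = euler_step (c + INR k) (Derive_n g k).
Proof.
  intros Sg; induction k as [|k IH]; [simpl; rewrite Rplus_0_r; reflexivity|].
  apply functional_extensionality; intros x; simpl Derive_n; rewrite IH, S_INR.
  rewrite <- Rplus_assoc; apply is_derive_unique, is_derive_euler_step, smooth_Derive_n, Sg.
Qed.

Lemma tame_euler_step (c : R) : tame (euler_step c).
Proof.
  apply tame_intro.
  - intros f Sf [|k] x; [exact I|]; simpl; rewrite Derive_n_euler_step by exact Sf.
    eexists; apply is_derive_euler_step, smooth_Derive_n, Sf.
  - intros f g a b Sf Sg; apply functional_extensionality; intros x; unfold euler_step.
    assert (E : Derive (fun x => a * f x + b * g x) x = a * Derive f x + b * Derive g x)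
      by exact (equal_f (Derive_n_lin f g a b 1 Sf Sg) x).
    rewrite E; ring.
  (* One derivative is lost, and [a] bounds the factor [x] in front of it. *)
  - intros k a Ha; exists (S k), (Rabs (c + INR k) + a).
    assert (Hc := Rabs_pos (c + INR k)); split; [lra|].
    intros f A Sf Bf x Hx; rewrite Derive_n_euler_step by exact Sf; unfold euler_step.
    assert (B1 := Bf k x (Nat.le_succ_diag_r k) Hx); assert (B2 := Bf (S k) x (le_n _) Hx).
    apply Rle_trans with (1 := Rabs_triang _ _); rewrite !Rabs_mult, Rmult_plus_distr_r.
    apply Rplus_le_compat; apply Rmult_le_compat; auto using Rabs_pos; lra.
Qed.

Lemma tame_theta_prod (n : nat) : tame (theta_prod n).
Proof.
  induction n as [|n IH]; [exact tame_id|].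
  exact (tame_comp _ _ (tame_euler_step (INR (S n))) IH).
Qed.

Lemma theta_prod_monomial (n m : nat) :
  theta_prod n (fun x => x ^ m) = fun x => rising n (INR m) * x ^ m.
Proof.
  induction n as [|n IH]; [apply functional_extensionality; intros x; simpl; ring|].
  apply functional_extensionality; intros x.
  change (theta_prod (S n) (fun x => x ^ m) x) with
    (INR (S n) * theta_prod n (fun x => x ^ m) x + x * Derive (theta_prod n (fun x => x ^ m)) x).
  rewrite IH.
  replace (Derive _ x) with (rising n (INR m) * (INR m * x ^ pred m)).
  2:{ symmetry; apply is_derive_unique; auto_derive; [exact I|ring]. }
  change (rising (S n) (INR m)) with ((INR (S n) + INR m) * rising n (INR m)).
  (* For [m = 0] the truncated [pred] leaves [x^0], but the factor [INR 0] removes the term. *)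
  destruct m as [|m]; simpl pow; simpl pred; [simpl (INR 0); ring|ring].
Qed.

Lemma tame_scal (T : (R -> R) -> R -> R) (f : R -> R) (c : R) : tame T -> smooth f ->
  T (fun x => c * f x) = fun x => c * T f x.
Proof.
  intros [_ [HT _]] Sf; assert (H := HT f f c 0 Sf Sf).
  replace (fun x => c * f x) with (fun x => c * f x + 0 * f x)
    by (apply functional_extensionality; intros x; ring).
  rewrite H; apply functional_extensionality; intros x; ring.
Qed.

(** * The two operators and their action on monomials *)

Lemma continuous_rpow_1_minus (a x : R) : 0 < x < 1 -> continuous (fun t => rpow (1 - t) a) x.
Proof.
  intros Hx; apply (continuous_ext_loc _ (fun t => Rpower (1 - t) a)).
  - assert (H : 0 < 1 - x) by lra; exists (mkposreal _ H); intros y Hy.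
    rewrite rpow_Rpower; [reflexivity|].
    change (Rabs (y - x) < 1 - x) in Hy; revert Hy; unfold Rabs; destruct Rcase_abs; lra.
  - apply continuous_Rpower_1_minus; lra.
Qed.

Lemma continuous_rpow (a x : R) : 0 < x -> continuous (fun t => rpow t a) x.
Proof.
  intros Hx; apply (continuous_ext_loc _ (fun t => Rpower t a)).
  - exists (mkposreal _ Hx); intros y Hy.
    rewrite rpow_Rpower; [reflexivity|].
    change (Rabs (y - x) < x) in Hy; revert Hy; unfold Rabs; destruct Rcase_abs; lra.
  - apply continuous_Rpower, Hx.
Qed.

Lemma is_RInt01_chi_moment (kappa : R) (m : nat) : 0 < kappa ->
  is_RInt01 (fun t => rpow (1 - t) (kappa - 1) * t ^ m) (beta01 kappa (INR m)).
Proof.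
  intros Hk; assert (H := beta01_correct kappa (INR m) Hk (pos_INR m)).
  revert H; apply (is_RInt_gen_ext_on _ _ _ _ _ _ joins_01); intros t Ht.
  rewrite rpow_Rpower, Rpower_pow by lra; reflexivity.
Qed.

Lemma is_RInt01_EK_moment (gamma delta : R) (m : nat) : 0 <= gamma -> 0 < delta ->
  is_RInt01 (fun t => rpow (1 - t) (delta - 1) * rpow t gamma * t ^ m) (beta01 delta (gamma + INR m)).
Proof.
  intros Hg Hd; assert (Hm := pos_INR m); assert (Hp : 0 <= gamma + INR m) by lra.
  assert (H := beta01_correct delta _ Hd Hp).
  revert H; apply (is_RInt_gen_ext_on _ _ _ _ _ _ joins_01); intros t Ht.
  rewrite !rpow_Rpower, Rpower_plus, Rpower_pow by lra; ring.
Qed.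

Lemma weight_chi (kappa : R) : 0 < kappa -> weight (fun t => rpow (1 - t) (kappa - 1)).
Proof.
  intros Hk; split; [|split].
  - intros t Ht; apply continuous_rpow_1_minus, Ht.
  - intros t Ht; rewrite rpow_Rpower by lra; apply Rlt_le, Rpower_gt0.
  - exists (beta01 kappa (INR 0)); assert (H := is_RInt01_chi_moment kappa 0 Hk).
    revert H; apply (is_RInt_gen_ext_on _ _ _ _ _ _ joins_01); intros; simpl; ring.
Qed.

Lemma weight_EK (gamma delta : R) : 0 <= gamma -> 0 < delta ->
  weight (fun t => rpow (1 - t) (delta - 1) * rpow t gamma).
Proof.
  intros Hg Hd; split; [|split].
  - intros t Ht; apply (continuous_mult (K := R_AbsRing) (fun t => rpow (1 - t) (delta - 1)) (fun t => rpow t gamma));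
      [apply continuous_rpow_1_minus, Ht|apply continuous_rpow, Ht].
  - intros t Ht; rewrite !rpow_Rpower by lra; apply Rmult_le_pos; apply Rlt_le, Rpower_gt0.
  - exists (beta01 delta (gamma + INR 0)); assert (H := is_RInt01_EK_moment gamma delta 0 Hg Hd).
    revert H; apply (is_RInt_gen_ext_on _ _ _ _ _ _ joins_01); intros; simpl; ring.
Qed.

Lemma tame_chi (kappa : R) : 0 < kappa -> tame (chi kappa).
Proof. intros Hk; exact (tame_dilation_mean _ (/ Gamma kappa) (weight_chi kappa Hk)). Qed.

Lemma chi_monomial (kappa : R) (m : nat) : 0 < kappa ->
  chi kappa (fun x => x ^ m) = fun x => / Gamma kappa * beta01 kappa (INR m) * x ^ m.
Proof.
  intros Hk; apply functional_extensionality; intros x.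
  assert (E := equal_f (dilation_mean_monomial _ m _ (is_RInt01_chi_moment kappa m Hk)) x).
  unfold dilation_mean in E; unfold chi; rewrite E; ring.
Qed.

Lemma EK_0 (gamma : R) : EK gamma 0 = fun f => f.
Proof. unfold EK; destruct (Req_EM_T 0 0); [reflexivity|contradiction]. Qed.

Lemma EK_gt0 (gamma delta : R) : 0 < delta ->
  EK gamma delta = fun f x => / Gamma delta *
    dilation_mean (fun t => rpow (1 - t) (delta - 1) * rpow t gamma) f x.
Proof. intros Hd; unfold EK; destruct (Req_EM_T delta 0); [lra|reflexivity]. Qed.

Lemma tame_EK (gamma delta : R) : 0 <= gamma -> 0 <= delta -> tame (EK gamma delta).
Proof.
  intros Hg [Hd|<-]; [rewrite EK_gt0 by exact Hd|rewrite EK_0; exact tame_id].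
  apply tame_dilation_mean, weight_EK; assumption.
Qed.

Lemma EK_monomial (gamma delta : R) (m : nat) : 0 <= gamma -> 0 < delta ->
  EK gamma delta (fun x => x ^ m) = fun x => / Gamma delta * beta01 delta (gamma + INR m) * x ^ m.
Proof.
  intros Hg Hd; rewrite EK_gt0 by exact Hd; apply functional_extensionality; intros x.
  rewrite (dilation_mean_monomial _ m _ (is_RInt01_EK_moment gamma delta m Hg Hd)); ring.
Qed.

(** For [kappa = INR n] the inner operator is the identity, so the eigenvalue is [rising n (INR m)]
    alone and the one-integral identity replaces the two-integral one. *)
Lemma theta_prod_EK_monomial (kappa : R) (n m : nat) : 0 < kappa <= INR n ->
  exists c, theta_prod n (EK kappa (INR n - kappa) (fun x => x ^ m)) = (fun x => c * x ^ m) /\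
    c * (/ Gamma kappa * beta01 kappa (INR m)) = 1.
Proof.
  intros [Hk [Hn|Hn]].
  - assert (Hd : 0 < INR n - kappa) by lra.
    exists (/ Gamma (INR n - kappa) * beta01 (INR n - kappa) (kappa + INR m) * rising n (INR m)); split.
    + rewrite EK_monomial, (tame_scal _ _ _ (tame_theta_prod n) (smooth_monomial m)), theta_prod_monomial
        by lra.
      apply functional_extensionality; intros x; ring.
    + assert (B := beta01_rising kappa n m Hk Hn).
      assert (G1 := Gamma_gt0 kappa Hk); assert (G2 := Gamma_gt0 _ Hd).
      transitivity ((beta01 kappa (INR m) * beta01 (INR n - kappa) (kappa + INR m) * rising n (INR m))
        / (Gamma kappa * Gamma (INR n - kappa))); [field; lra|]; rewrite B; field; lra.
  - exists (rising n (INR m)); split.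
    + replace (INR n - kappa) with 0 by lra; rewrite EK_0; apply theta_prod_monomial.
    + rewrite Hn in *; assert (G := Gamma_gt0 _ Hk).
      assert (B := beta01_rising_integer n m (INR_lt 0 n Hk)).
      transitivity ((beta01 (INR n) (INR m) * rising n (INR m)) / Gamma (INR n)); [field; lra|].
      rewrite B; field; lra.
Qed.

Theorem theorem5p3 (kappa : R) (n : nat) :
  0 < kappa -> INR n - 1 < kappa <= INR n ->
  let chi_inv := fun f => theta_prod n (EK kappa (INR n - kappa) f) in
  maps_smooth (chi kappa) /\ Cinf_continuous (chi kappa) /\
  maps_smooth chi_inv /\ Cinf_continuous chi_inv /\
  (forall f, smooth f -> chi_inv (chi kappa f) = f) /\
  (forall f, smooth f -> chi kappa (chi_inv f) = f).
Proof.
  intros Hk Hn chi_inv.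
  assert (T1 : tame (chi kappa)) by (apply tame_chi, Hk).
  assert (T2 : tame chi_inv).
  { apply (tame_comp (theta_prod n) (EK kappa (INR n - kappa))); [apply tame_theta_prod|].
    apply tame_EK; lra. }
  (* Both operators are diagonal on monomials, so the single relation [c' * c = 1] settles the two
     orders of composition. *)
  assert (M : forall m, exists c c', chi kappa (fun x => x ^ m) = (fun x => c * x ^ m) /\
    chi_inv (fun x => x ^ m) = (fun x => c' * x ^ m) /\ c' * c = 1).
  { intros m; destruct (theta_prod_EK_monomial kappa n m) as [c [E1 E2]]; [lra|].
    exists (/ Gamma kappa * beta01 kappa (INR m)), c; split; [apply chi_monomial, Hk|split; assumption]. }
  split; [apply T1|split; [apply tame_continuous, T1|]].
  split; [apply T2|split; [apply tame_continuous, T2|]].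
  split.
  - apply (tame_eq_id (fun f => chi_inv (chi kappa f)) (tame_comp _ _ T2 T1)); intros m.
    destruct (M m) as [c [c' [E1 [E2 E3]]]].
    rewrite E1, (tame_scal _ _ _ T2 (smooth_monomial m)), E2.
    apply functional_extensionality; intros x.
    rewrite <- Rmult_assoc, (Rmult_comm c c'), E3; ring.
  - apply (tame_eq_id (fun f => chi kappa (chi_inv f)) (tame_comp _ _ T1 T2)); intros m.
    destruct (M m) as [c [c' [E1 [E2 E3]]]].
    rewrite E2, (tame_scal _ _ _ T1 (smooth_monomial m)), E1.
    apply functional_extensionality; intros x.
    rewrite <- Rmult_assoc, E3; ring.
Qed.
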